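(* Let $m,n$ be coprime positive integers and $G_{m,n}=\langle x,y\mid x^m=y^n\rangle$. Define $\Psi:X(G_{m,n})\to\mathbb{C}^3$ by $\Psi(\chi_\rho)=(\mathrm{tr}\,A,\mathrm{tr}\,B,\mathrm{tr}\,AB)$, where $\rho=(A,B)$, $A=\rho(x)$, $B=\rho(y)$. Then $\Psi$ is an isomorphism onto its image $C=\Psi(X(G_{m,n}))$. The curve $C$ has exactly $\frac{(m-1)(n-1)}{2}+1$ irreducible components, each smooth and isomorphic to $\mathbb{C}$: one component is the image of the locus $X_{red}$ of reducible characters, and the other $\frac{(m-1)(n-1)}{2}$ components are the images of the lines $X^{k,k'}_{irr}$ ($0<k<m$, $0<k'<n$, $k\equiv k'\pmod 2$) making up the closure $X_{irr}$ of the irreducible characters. These latter components are pairwise disjoint, each meets the reducible component in exactly two points, all these $(m-1)(n-1)$ intersection points are distinct, and at each of them the two components meet transversally, forming a nodal (normal crossing) singularity; $C$ has no other singularities.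
   Context: $G_{m,n}$ is the fundamental group of the complement of the $(m,n)$ torus knot. Representations $\rho:G_{m,n}\to\mathrm{SL}(2,\mathbb{C})$ are pairs $(A,B)\in\mathrm{SL}(2,\mathbb{C})^2$ with $A^m=B^n$; $X(G_{m,n})$ is the set of characters $\chi_\rho(g)=\mathrm{tr}\,\rho(g)$ with its Culler–Shalen algebraic structure. A representation is reducible if $A,B$ share an eigenvector, irreducible otherwise. $X_{red}$ is the set of reducible characters; it consists of the characters of $(\mathrm{diag}(t^n,t^{-n}),\mathrm{diag}(t^m,t^{-m}))$, $t\in\mathbb{C}^*$. $X_{irr}$ is the closure of the set of irreducible characters; it consists of the characters of the pairs $A=\mathrm{diag}(\lambda,\lambda^{-1})$, $B=P\,\mathrm{diag}(\mu,\mu^{-1})P^{-1}$ with $P=\begin{pmatrix}1&r-1\\1&r\end{pmatrix}$, $r\in\mathbb{C}$, where $\lambda=e^{\pi ik/m}$, $\mu=e^{\pi ik'/n}$, $0<k<m$, $0<k'<n$, $k\equiv k'\pmod 2$; for fixed $(k,k')$ these form the line $X^{k,k'}_{irr}$. *)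

(* Defs.v *)
From HB Require Import structures.
From mathcomp Require Import all_boot all_order all_algebra.
From mathcomp Require Import reals complex.
From mathcomp Require Import mpoly.
From mathcomp Require trigo.

Set Implicit Arguments.
Unset Strict Implicit.
Unset Printing Implicit Defensive.

Import Order.TTheory GRing.Theory Num.Theory.
Local Open Scope ring_scope.

(* Letters of words in the generators x, y of G_{m,n} = < x, y | x^m = y^n >:
   x, x^-1, y, y^-1.  Group elements of G_{m,n} are represented by words. *)
Inductive letter := Lx | Lxi | Ly | Lyi.

Section TorusKnotCharacters.
Variable R : realType.
Local Notation C := (complex R).

Definition pt := 'rV[C]_3.

Definition torus_rep (m n : nat) (A B : 'M[C]_2) : Prop :=
  \det A = 1 /\ \det B = 1 /\ A ^+ m = B ^+ n.

Definition letter_mx (A B : 'M[C]_2) (l : letter) : 'M[C]_2 :=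
  match l with Lx => A | Lxi => invmx A | Ly => B | Lyi => invmx B end.

Fixpoint word_mx (A B : 'M[C]_2) (w : seq letter) : 'M[C]_2 :=
  match w with
  | [::] => 1%:M
  | l :: w' => letter_mx A B l *m word_mx A B w'
  end.

Definition character (A B : 'M[C]_2) : seq letter -> C :=
  fun w => \tr (word_mx A B w).

Definition char_var (m n : nat) (chi : seq letter -> C) : Prop :=
  exists A B, torus_rep m n A B /\ chi = character A B.

Definition reducible (A B : 'M[C]_2) : Prop :=
  exists v : 'cV[C]_2, v != 0 /\
    exists a b : C, A *m v = a *: v /\ B *m v = b *: v.

Definition X_red (m n : nat) (chi : seq letter -> C) : Prop :=
  exists A B, [/\ torus_rep m n A B, reducible A B & chi = character A B].

Definition expipi (k m : nat) : C :=
  Complex (trigo.cos (trigo.pi * k%:R / m%:R))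
          (trigo.sin (trigo.pi * k%:R / m%:R)).

Definition diag2 (a : C) : 'M[C]_2 :=
  diag_mx (\row_(i < 2) [:: a; a^-1]`_i).

Definition Pmat (r : C) : 'M[C]_2 :=
  \matrix_(i < 2, j < 2)
    (if i == 0 :> nat then (if j == 0 :> nat then 1 else r - 1)
     else (if j == 0 :> nat then 1 else r)).

Definition X_irr_line (m n k k' : nat) (chi : seq letter -> C) : Prop :=
  exists r : C,
    chi = character (diag2 (expipi k m))
                    (Pmat r *m diag2 (expipi k' n) *m invmx (Pmat r)).

Definition Psi (chi : seq letter -> C) : pt :=
  \row_(i < 3) [:: chi [:: Lx]; chi [:: Ly]; chi [:: Lx; Ly]]`_i.

Definition image_of (S : (seq letter -> C) -> Prop) (p : pt) : Prop :=
  exists chi, S chi /\ p = Psi chi.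

Definition Ccurve (m n : nat) : pt -> Prop := image_of (char_var m n).
Definition Cred (m n : nat) : pt -> Prop := image_of (X_red m n).
Definition Cirr (m n k k' : nat) : pt -> Prop := image_of (X_irr_line m n k k').

Definition evp (f : {mpoly C[3]}) (p : pt) : C := f.@[fun i => p ord0 i].

Definition subset_pt (S T : pt -> Prop) : Prop := forall p, S p -> T p.
Definition seteq_pt (S T : pt -> Prop) : Prop := forall p, S p <-> T p.

Definition zclosed (S : pt -> Prop) : Prop :=
  exists F : seq {mpoly C[3]}, forall p, S p <-> all (fun f => evp f p == 0) F.

Definition irreducible_set (S : pt -> Prop) : Prop :=
  [/\ zclosed S, exists p, S p &
      forall S1 S2, zclosed S1 -> zclosed S2 ->
        subset_pt S (fun p => S1 p \/ S2 p) -> subset_pt S S1 \/ subset_pt S S2].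

Definition irr_component (S T : pt -> Prop) : Prop :=
  [/\ subset_pt T S, irreducible_set T &
      forall T', irreducible_set T' -> subset_pt T T' -> subset_pt T' S ->
        subset_pt T' T].

Definition polymap (phi : 'I_3 -> {poly C}) (t : C) : pt :=
  \row_(i < 3) (phi i).[t].

Definition iso_to_line (T : pt -> Prop) : Prop :=
  exists (phi : 'I_3 -> {poly C}) (psi : {mpoly C[3]}),
    [/\ forall t, T (polymap phi t),
        forall t, evp psi (polymap phi t) = t &
        forall p, T p -> polymap phi (evp psi p) = p].

Definition tangent_space (S : pt -> Prop) (p : pt) (v : pt) : Prop :=
  forall f : {mpoly C[3]}, (forall q, S q -> evp f q = 0) ->
    \sum_(i < 3) evp (f^`M(i)) p * v ord0 i = 0.

Definition line_space (V : pt -> Prop) : Prop :=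
  exists v : pt, v != 0 /\ forall w, V w <-> exists c : C, w = c *: v.

Definition smooth_point (S : pt -> Prop) (p : pt) : Prop :=
  line_space (tangent_space S p).

(* the two curves T1, T2 (through p) meet transversally at p, and S has an
   ordinary node at p with branches T1, T2: the tangent space of S at p is
   the direct sum of the (distinct) tangent lines of T1 and T2 *)
Definition node_of (S T1 T2 : pt -> Prop) (p : pt) : Prop :=
  [/\ smooth_point T1 p, smooth_point T2 p,
      (forall w, tangent_space T1 p w -> tangent_space T2 p w -> w = 0) &
      (forall w, tangent_space S p w <->
         exists u v, [/\ tangent_space T1 p u, tangent_space T2 p v & w = u + v])].

End TorusKnotCharacters.

Definition Kset (m n : nat) : {set 'I_m * 'I_n} :=
  [set kk : 'I_m * 'I_n | [&& (0 < kk.1)%N, (0 < kk.2)%N & odd kk.1 == odd kk.2]].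

Arguments char_var : clear implicits.
Arguments X_red : clear implicits.
Arguments X_irr_line : clear implicits.
Arguments Ccurve : clear implicits.
Arguments Cred : clear implicits.
Arguments Cirr : clear implicits.
Arguments pt : clear implicits.

(* Main.v *)
(* The trace coordinates of a word are polynomials in (x,y,z) = (tr A, tr B, tr AB)
   (Fricke), so Psi is injective with polynomial inverse.  By Cayley-Hamilton,
   A^m = U_m(x) A - U_{m-1}(x), so if U_m(x) <> 0 then A^m = B^n commutes with B only
   if AB = BA, and the pair is reducible; otherwise x = 2 cos(pi k/m) and likewise
   y = 2 cos(pi k'/n), while z is free.  With s = t + 1/t the reducible locus is the
   polynomial curve (D_n(s), D_m(s), D_{m+n}(s)) in Dickson polynomials; it is a line
   because s is the trace of a word x^u y^v with u n + v m = 1.  So every component is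
   a polynomial embedding phi of the line with polynomial left inverse, hence closed,
   irreducible and smooth with tangent phi'.  At an intersection point the gradient of
   the equation tr A^(m+1) = tr (B^n A) is nonzero, which bounds the tangent space of C
   by the sum of the two branch tangents. *)
Require Import Defs.
From HB Require Import structures.
From mathcomp Require Import all_boot all_order all_algebra.
From mathcomp Require Import reals complex.
From mathcomp Require Import mpoly ring.
From mathcomp Require trigo.
From Stdlib Require Import FunctionalExtensionality.

Set Implicit Arguments.
Unset Strict Implicit.
Unset Printing Implicit Defensive.

Import Order.TTheory GRing.Theory Num.Theory.
Local Open Scope ring_scope.

(** * Zariski-closed sets in affine 3-space, their tangent spaces, and polynomially embedded
    lines *)

Section LineEmbeddings.
Variable R : realType.
Local Notation C := (complex R).
Local Notation pt := (pt R).
Implicit Types (S T : pt -> Prop) (p v w : pt) (f g : {mpoly C[3]}).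

Lemma evpD f g p : evp (f + g) p = evp f p + evp g p.
Proof. exact: mevalD. Qed.

Lemma evpB f g p : evp (f - g) p = evp f p - evp g p.
Proof. exact: mevalB. Qed.

Lemma evpM f g p : evp (f * g) p = evp f p * evp g p.
Proof. exact: mevalM. Qed.

Lemma evpC (c : C) p : evp (c%:MP) p = c.
Proof. exact: mevalC. Qed.

Lemma evpX i p : evp 'X_i p = p ord0 i.
Proof. exact: mevalXU. Qed.

Lemma mderivXU i j : ('X_i : {mpoly C[3]})^`M(j) = (i == j)%:R.
Proof.
rewrite mderivX mnm1E; case: eqVneq => [->|_]; last by rewrite scale0r.
rewrite scale1r -[RHS](mpolyX0 3 C); congr 'X_[_].
by apply/mnmP => k; rewrite mnmBE mnm0E subnn.
Qed.

(** Reduces identities between ring morphisms and derivations to constants and variables, since a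
    monomial is a product of powers of variables. *)
Lemma mpoly_ring_ind (P : {mpoly C[3]} -> Prop) :
  (forall c, P c%:MP) -> (forall i, P 'X_i) ->
  (forall f g, P f -> P g -> P (f + g)) ->
  (forall f g, P f -> P g -> P (f * g)) -> forall f, P f.
Proof.
move=> PC PX PD PM; elim/mpolyind => [|c m f _ _ IH].
  by rewrite -(mpolyC0 3); exact: PC.
apply: (PD) => //; rewrite -mul_mpolyC; apply: (PM) => //.
rewrite mpolyXE_id; apply: (big_ind P) => [|f1 g1|i _].
- by rewrite -(mpolyC1 3); exact: PC.
- exact: (PM).
elim: (m i) => [|k IHk]; first by rewrite expr0 -(mpolyC1 3); exact: PC.
by rewrite exprS; apply: PM.
Qed.

(** In characteristic zero the naturals below [size (p - q)] are distinct roots of the difference,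
    one more than a nonzero polynomial of that size can have. *)
Lemma poly_funext (p q : {poly C}) : (forall t, p.[t] = q.[t]) -> p = q.
Proof.
move=> pq; apply/eqP; rewrite -subr_eq0; apply/negPn/negP => nz.
set rs : seq C := [seq k%:R | k <- iota 0 (size (p - q))].
have := max_poly_roots nz (rs := rs).
rewrite size_map size_iota ltnn => h; suff : false by []; apply: h.
  by apply/allP => t _; rewrite rootE !hornerE pq subrr.
rewrite map_inj_uniq ?iota_uniq // => i j /eqP.
by rewrite eqr_nat => /eqP.
Qed.

(** Restriction of [f] to the parametrised curve, kept as a polynomial so that vanishing on the
    curve is equality to zero in an integral domain. *)
Definition pullback (phi : 'I_3 -> {poly C}) f : {poly C} := mmap polyC phi f.

Lemma horner_pullback phi f t : (pullback phi f).[t] = evp f (polymap phi t).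
Proof.
rewrite /pullback; elim/mpoly_ring_ind: f => [c|i|f g IHf IHg|f g IHf IHg].
- by rewrite mmapC hornerC evpC.
- by rewrite mmapX mmap1U evpX mxE.
- by rewrite mmapD hornerD IHf IHg evpD.
by rewrite rmorphM hornerM IHf IHg evpM.
Qed.

(** Chain rule: both sides are additive and satisfy the same Leibniz rule in [f]. *)
Lemma deriv_pullback phi f :
  (pullback phi f)^`() = \sum_(i < 3) pullback phi (f^`M(i)) * (phi i)^`().
Proof.
rewrite /pullback; elim/mpoly_ring_ind: f => [c|i|f g IHf IHg|f g IHf IHg].
- rewrite mmapC derivC big1 // => i _.
  by rewrite mderivC mmap0 mul0r.
- rewrite mmapX mmap1U (bigD1 i) //= big1 => [|j ji].
    by rewrite mderivXU eqxx rmorph1 mul1r addr0.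
  by rewrite mderivXU eq_sym (negPf ji) mmap0 mul0r.
- rewrite mmapD derivD IHf IHg -big_split; apply: eq_bigr => i _ /=.
  by rewrite mderivD mmapD mulrDl.
rewrite rmorphM derivM IHf IHg mulr_suml mulr_sumr -big_split.
by apply: eq_bigr => i _ /=; rewrite mderivM mmapD !rmorphM /=; ring.
Qed.

Definition velocity (phi : 'I_3 -> {poly C}) (t : C) : pt :=
  polymap (fun i => (phi i)^`()) t.

Lemma deriv_evp_polymap phi f t :
  (pullback phi f)^`().[t] =
  \sum_(i < 3) evp (f^`M(i)) (polymap phi t) * velocity phi t ord0 i.
Proof.
rewrite deriv_pullback horner_sum; apply: eq_bigr => i _.
by rewrite hornerM horner_pullback mxE.
Qed.

(** The composite [q(f)]. With a left inverse [psi] of a parametrisation [phi] it yields the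
    equations [phi_i(psi) = X_i] of the curve. *)
Definition subst (q : {poly C}) f : {mpoly C[3]} := (map_poly (@mpolyC 3 C) q).[f].

Lemma evp_subst q f p : evp (subst q f) p = q.[evp f p].
Proof.
rewrite /subst; elim/poly_ind: q => [|q c IH].
  by rewrite rmorph0 !horner0 /evp meval0.
by rewrite rmorphD rmorphM /= map_polyX map_polyC !hornerE evpD evpM IH evpC.
Qed.

Lemma mderiv_subst q f i : (subst q f)^`M(i) = subst q^`() f * f^`M(i).
Proof.
rewrite /subst; elim/poly_ind: q => [|q c IH].
  by rewrite deriv0 rmorph0 !horner0 mderiv0 mul0r.
rewrite derivD derivM derivX derivC addr0 mulr1.
rewrite !rmorphD !rmorphM /= map_polyX map_polyC !hornerE.
by rewrite mderivD mderivM mderivC IH /=; ring.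
Qed.

(** The union is cut out by all products of an equation of [S] and one of [T]: if some [f] is
    nonzero at [p], its products force every [g] to vanish there. *)
Lemma zclosedU S T : zclosed S -> zclosed T -> zclosed (fun p => S p \/ T p).
Proof.
move=> [F SF] [G TG]; exists [seq f * g | f <- F, g <- G] => p; split.
  move=> [/SF/allP pF|/TG/allP pG]; apply/allP => h /allpairsP[[f g]] /=;
    move=> [fF gG ->]; rewrite evpM mulf_eq0.
    by rewrite pF ?orTb.
  by rewrite (pG g gG) orbT.
move/allP=> pFG; case: (boolP (all (fun f => evp f p == 0) F)); first by left; apply/SF.
case/allPn=> f fF nf; right; apply/TG/allP => g gG.
have := pFG (f * g); rewrite evpM mulf_eq0 (negPf nf) /=; apply.
by apply/allpairsP; exists (f, g).
Qed.

Lemma zclosed_ext S T : seteq_pt S T -> zclosed S -> zclosed T.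
Proof. by move=> ST [F SF]; exists F => p; rewrite -SF; split=> /ST. Qed.

Lemma zclosed_bigU (I : eqType) (r : seq I) (U : I -> pt -> Prop) :
  (forall i, i \in r -> zclosed (U i)) ->
  zclosed (fun p => exists2 i, i \in r & U i p).
Proof.
elim: r => [|i r IH] cU.
  (* The empty union is cut out by the constant polynomial 1. *)
  by exists [:: 1] => p; split => [[]//|]; rewrite /= /evp meval1 oner_eq0.
have [//||F SF] := @zclosedU (U i) (fun p => exists2 j, j \in r & U j p).
- by apply: cU; rewrite mem_head.
- by apply: IH => j jr; apply: cU; rewrite inE jr orbT.
exists F => p; rewrite -SF; split.
  by move=> [j]; rewrite inE => /orP[/eqP -> |jr]; [left|right; exists j].
move=> [Up|[j jr Up]]; [exists i|exists j] => //.
  by rewrite mem_head.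
by rewrite inE jr orbT.
Qed.

Lemma zclosed_separate S p : zclosed S -> ~ S p ->
  exists2 f, forall q, S q -> evp f q = 0 & evp f p != 0.
Proof.
move=> [F SF] nSp; have /allPn[f fF nf] : ~~ all (fun f => evp f p == 0) F.
  by apply/negP => /SF.
by exists f => // q /SF/allP/(_ f fF)/eqP.
Qed.

Lemma irreducible_set_ext S T : seteq_pt S T -> irreducible_set S -> irreducible_set T.
Proof.
move=> ST [cS [p Sp] iS]; split; first exact: zclosed_ext cS.
  by exists p; apply/ST.
move=> S1 S2 c1 c2 T12.
by case: (iS S1 S2 c1 c2) => [q /ST/T12//|h|h]; [left|right] => q /ST/h.
Qed.

Lemma irreducible_set_bigU (I : eqType) (r : seq I) (U : I -> pt -> Prop) T :
  (forall i, i \in r -> zclosed (U i)) -> irreducible_set T ->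
  subset_pt T (fun p => exists2 i, i \in r & U i p) ->
  exists2 i, i \in r & subset_pt T (U i).
Proof.
move=> cU [_ [p0 Tp0] iT]; elim: r cU => [|i r IH] cU TU.
  by have [] := TU p0 Tp0.
have cr j : j \in r -> zclosed (U j) by move=> jr; apply: cU; rewrite inE jr orbT.
case: (iT (U i) (fun p => exists2 j, j \in r & U j p)) => [|||h|/IH].
- by apply: cU; rewrite mem_head.
- exact: zclosed_bigU.
- move=> p /TU[j]; rewrite inE => /orP[/eqP -> |jr]; first by left.
  by right; exists j.
- by exists i; rewrite ?mem_head.
by case=> // j jr Tj; exists j; rewrite ?inE ?jr ?orbT.
Qed.

(** A maximal irreducible set lies in some [U i], hence equals it. Conversely an irreducible set
    containing [U i] lies in some [U j], and the antichain hypothesis gives [i = j]. *)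
Lemma irr_component_bigU (I : eqType) (r : seq I) (U : I -> pt -> Prop) S T :
  (forall i, i \in r -> irreducible_set (U i)) ->
  (forall i j, i \in r -> j \in r -> subset_pt (U i) (U j) -> i = j) ->
  seteq_pt S (fun p => exists2 i, i \in r & U i p) ->
  irr_component S T <-> exists2 i, i \in r & seteq_pt T (U i).
Proof.
move=> iU anti SU; have cU i : i \in r -> zclosed (U i) by case/iU.
split=> [[TS iT maxT]|[i ir TUi]].
  have [|i ir TUi] := irreducible_set_bigU cU iT; first by move=> p /TS/SU.
  exists i => // p; split; first exact: TUi.
  by apply: (maxT (U i)) => //; [exact: iU|move=> q Uq; apply/SU; exists i].
split.
- by move=> p /TUi Up; apply/SU; exists i.
- by apply: irreducible_set_ext (iU i ir) => p; split=> /TUi.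
move=> T' iT' TT' T'S p T'p; apply/TUi.
have [|j jr T'Uj] := irreducible_set_bigU cU iT'; first by move=> q /T'S/SU.
suff -> : i = j by exact: T'Uj.
by apply: anti => // q /TUi/TT'/T'Uj.
Qed.

Lemma tangent_space_sub S T p v :
  subset_pt T S -> tangent_space T p v -> tangent_space S p v.
Proof. by move=> TS vT f fS; apply: vT => q /TS/fS. Qed.

Lemma tangent_spaceD S p v w :
  tangent_space S p v -> tangent_space S p w -> tangent_space S p (v + w).
Proof.
move=> vS wS f fS; 
have := congr2 +%R (vS f fS) (wS f fS); rewrite addr0 -big_split => e.
by rewrite -[RHS]e; apply: eq_bigr => i _; rewrite mxE mulrDr.
Qed.

(* Multiplying an equation f of T by an equation g of T' with g(p) <> 0 gives
   an equation of S whose differential at p is g(p) df. *)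
Lemma tangent_space_local S T T' p v :
  seteq_pt S (fun q => T q \/ T' q) -> zclosed T' -> T p -> ~ T' p ->
  tangent_space S p v <-> tangent_space T p v.
Proof.
move=> STT' cT' Tp nT'p; split; last first.
  by apply: tangent_space_sub => q Tq; apply/STT'; left.
have [g gT' gp] := zclosed_separate cT' nT'p.
move=> vS f fT; apply/eqP; rewrite -(mulrI_eq0 _ (mulfI gp)) mulr_sumr; apply/eqP.
rewrite -[RHS](vS (f * g)) => [|q /STT'[/fT|/gT'] e]; last 2 first.
- by rewrite evpM e mul0r.
- by rewrite evpM e mulr0.
apply: eq_bigr => i _.
by rewrite mderivM evpD !evpM (fT p Tp) mul0r addr0; ring.
Qed.

(** Finitely many equations are tested by a boolean, so case analysis on membership needs no
    excluded middle. *)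
Lemma zclosed_dec S p : zclosed S -> S p \/ ~ S p.
Proof.
move=> [F SF]; case: (boolP (all (fun f => evp f p == 0) F)) => h.
  by left; apply/SF.
by right; apply/SF/negP.
Qed.

(** The other branches form a closed set missing [p], so by [tangent_space_local] the union has the
    tangent space of the single branch through [p]. *)
Lemma smooth_point_bigU (I : eqType) (r : seq I) (U : I -> pt -> Prop) S p i :
  (forall j, j \in r -> zclosed (U j)) ->
  seteq_pt S (fun q => exists2 j, j \in r & U j q) -> i \in r -> U i p ->
  (forall j, j \in r -> U j p -> j = i) ->
  smooth_point (U i) p -> smooth_point S p.
Proof.
move=> cU SU ir Uip only [v [v0 lv]]; exists v; split=> // w.
apply: iff_trans (lv w).
pose r' := [seq j <- r | j != i].
apply: (@tangent_space_local _ _ (fun q => exists2 j, j \in r' & U j q)) => //.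
- move=> q; split=> [/SU[j jr Ujq]|[Uiq|[j jr' Ujq]]].
  + case: (eqVneq j i) => [<-|ji]; first by left.
    by right; exists j; rewrite // mem_filter ji.
  + by apply/SU; exists i.
  by apply/SU; exists j => //; move: jr'; rewrite mem_filter => /andP[].
- by apply: zclosed_bigU => j; rewrite mem_filter => /andP[_ /cU].
by move=> [j]; rewrite mem_filter => /andP[/eqP ji jr] /only; auto.
Qed.

(** If the tangent space of [S] were a line, the two branch directions [v1] and [v2] would be
    proportional, against transversality. *)
Lemma node_not_smooth S T1 T2 p : node_of S T1 T2 p -> ~ smooth_point S p.
Proof.
move=> [[v1 [v10 l1]] [v2 [v20 l2]] disj sum] [v [_ lv]].
have t1 : tangent_space T1 p v1 by apply/l1; exists 1; rewrite scale1r.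
have t2 : tangent_space T2 p v2 by apply/l2; exists 1; rewrite scale1r.
have z1 : tangent_space T1 p 0 by apply/l1; exists 0; rewrite scale0r.
have z2 : tangent_space T2 p 0 by apply/l2; exists 0; rewrite scale0r.
have /lv[c1 e1] : tangent_space S p v1.
  by apply/sum; exists v1, 0; rewrite addr0.
have /lv[c2 e2] : tangent_space S p v2.
  by apply/sum; exists 0, v2; rewrite add0r.
have c20 : c2 != 0 by apply: contra_neq v20 => c20; rewrite e2 c20 scale0r.
move/eqP: v10; apply; apply: disj => //.
by apply/l2; exists (c1 / c2); rewrite e2 scalerA divfK.
Qed.

Section Line.
Variables (T : pt -> Prop) (phi : 'I_3 -> {poly C}) (psi : {mpoly C[3]}).
Hypotheses (phiT : forall t, T (polymap phi t))
  (psiK : forall t, evp psi (polymap phi t) = t)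
  (phiK : forall p, T p -> polymap phi (evp psi p) = p).

(** A common zero of the equations [phi_i(psi) = X_i] is [phi] evaluated at [psi(p)], so it lies on
    [T]. *)
Lemma line_zclosed : zclosed T.
Proof.
exists [seq subst (phi i) psi - 'X_i | i <- enum 'I_3] => p.
rewrite all_map; split=> [Tp|/allP Fp].
  apply/allP => i _ /=; rewrite evpB evp_subst evpX -{2}(phiK Tp) mxE.
  by rewrite subrr.
have <- : polymap phi (evp psi p) = p.
  apply/rowP => i; rewrite mxE; apply/eqP; rewrite -subr_eq0.
  have /= := Fp i; rewrite mem_enum => /(_ isT).
  by rewrite evpB evp_subst evpX.
exact: phiT.
Qed.

Lemma vanish_pullback f : (forall p, T p -> evp f p = 0) <-> pullback phi f = 0.
Proof.
split=> [fT|f0 p Tp]; last by rewrite -(phiK Tp) -horner_pullback f0 horner0.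
by apply: poly_funext => t; rewrite horner_pullback horner0 fT.
Qed.

(** The ideal of [T] is the kernel of [pullback phi], and it is prime because univariate polynomials
    form a domain. *)
Lemma line_irreducible : irreducible_set T.
Proof.
split; [exact: line_zclosed|by exists (polymap phi 0)|].
move=> S1 S2 [F SF] [G SG] TS.
case: (boolP (all (fun f => pullback phi f == 0) F)) => [/allP F0|/allPn[f fF f0]].
  by left=> p Tp; apply/SF/allP => f /F0/eqP/vanish_pullback ->.
right=> p Tp; apply/SG/allP => g gG.
suff /vanish_pullback -> : pullback phi g = 0 by [].
have : pullback phi (f * g) = 0.
  apply/vanish_pullback => q /TS[/SF/allP/(_ f fF)|/SG/allP/(_ g gG)] /eqP e.
    by rewrite evpM e mul0r.
  by rewrite evpM e mulr0.
by rewrite /pullback rmorphM /= => /eqP; rewrite mulf_eq0 (negPf f0) => /eqP.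
Qed.

(* The coordinate equations 'X_i = phi_i(psi) of T give w_i = dpsi(w) phi_i'. *)
Lemma line_tangent t w :
  tangent_space T (polymap phi t) w <-> exists c, w = c *: velocity phi t.
Proof.
split=> [wT|[c ->] f /vanish_pullback f0].
  exists (\sum_(j < 3) evp (psi^`M(j)) (polymap phi t) * w ord0 j).
  apply/rowP => i; rewrite !mxE.
  have /wT : forall q, T q -> evp (subst (phi i) psi - 'X_i) q = 0.
    by move=> q Tq; rewrite evpB evp_subst evpX -{2}(phiK Tq) mxE subrr.
  under eq_bigr => j _ do
    rewrite mderivB mderiv_subst evpB evpM evp_subst psiK mulrBl.
  rewrite sumrB => /eqP; rewrite subr_eq0 => /eqP e.
  transitivity (\sum_(j < 3) evp ('X_i^`M(j)) (polymap phi t) * w ord0 j).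
    rewrite (bigD1 i) //= big1 => [|j ji].
      by rewrite mderivXU eqxx /evp meval1 mul1r addr0.
    by rewrite mderivXU eq_sym (negPf ji) /evp meval0 mul0r.
  rewrite -e mulr_suml; apply: eq_bigr => j _.
  by ring.
have := deriv_evp_polymap phi f t; rewrite f0 deriv0 horner0 => e.
rewrite -[RHS](mulr0 c) [X in _ = c * X]e mulr_sumr; apply: eq_bigr => i _.
by rewrite !mxE; ring.
Qed.

(** Differentiating [psi(phi(t)) = t] gives 1 as the value of the differential of [psi] on the
    velocity. *)
Lemma velocity_neq0 t : velocity phi t != 0.
Proof.
apply/eqP => v0; have := deriv_evp_polymap phi psi t.
have -> : pullback phi psi = 'X.
  by apply: poly_funext => s; rewrite horner_pullback psiK hornerX.
rewrite derivX hornerC v0 big1 => [/eqP|i _]; last by rewrite mxE mulr0.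
by rewrite oner_eq0.
Qed.

Lemma line_smooth p : T p -> smooth_point T p.
Proof.
move=> Tp; exists (velocity phi (evp psi p)); split; first exact: velocity_neq0.
by move=> w; rewrite -{1}(phiK Tp); exact: line_tangent.
Qed.

End Line.

End LineEmbeddings.

(** * Second-order linear recurrences: Dickson and Chebyshev polynomials *)

Lemma two_step_ind (P : nat -> Prop) :
  P 0%N -> P 1%N -> (forall k, P k -> P k.+1 -> P k.+2) -> forall k, P k.
Proof.
move=> P0 P1 PSS k; suff [] : P k /\ P k.+1 by [].
by elim: k => // k [Pk Pk1]; split=> //; apply: PSS.
Qed.

Section Lucas.
Variable K : comNzRingType.
Implicit Types (c p q t u : K).

(** The recursion shifts the pair of initial values. At [c = t + 1/t], the initial values [2, c]
    give the Dickson polynomials and [0, 1] the Chebyshev polynomials of the second kind, up to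
    normalisation. *)
Fixpoint lucas c p q (k : nat) : K :=
  if k is k'.+1 then lucas c q (c * q - p) k' else p.

Lemma lucasSS c p q k : lucas c p q k.+2 = c * lucas c p q k.+1 - lucas c p q k.
Proof. by elim: k p q => [//|k IH] p q; exact: IH. Qed.

Lemma lucas_unique c (a : nat -> K) :
  (forall k, a k.+2 = c * a k.+1 - a k) -> a =1 lucas c (a 0%N) (a 1%N).
Proof.
by move=> aSS; elim/two_step_ind => // k IH IH1; rewrite aSS IH IH1 lucasSS.
Qed.

Lemma lucas_D t u k : t * u = 1 -> lucas (t + u) 2 (t + u) k = t ^+ k + u ^+ k.
Proof.
move=> tu; rewrite (@lucas_unique (t + u) (fun k => t ^+ k + u ^+ k)) //.
by move=> j; rewrite !exprS; ring: tu.
Qed.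

Lemma lucas_U t u k : t * u = 1 -> (t - u) * lucas (t + u) 0 1 k = t ^+ k - u ^+ k.
Proof.
move=> tu; elim/two_step_ind: k => [||k IH IH1]; rewrite ?lucasSS /=; try by ring.
by rewrite mulrBr mulrCA IH IH1 !exprS; ring: tu.
Qed.

Lemma lucas_V t u k : t * u = 1 ->
  (t - u) * lucas (t + u) 1 0 k = u ^+ k * t - t ^+ k * u.
Proof.
move=> tu; elim/two_step_ind: k => [||k IH IH1]; rewrite ?lucasSS /=; try by ring.
by rewrite mulrBr mulrCA IH IH1 !exprS; ring: tu.
Qed.

(** The degenerate case [t = 1/t], where [lucas_U] only reads [0 = 0]. *)
Lemma lucas_U_double t k : t * t = 1 -> t * lucas (t + t) 0 1 k = k%:R * t ^+ k.
Proof.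
move=> tt; elim/two_step_ind: k => [||k IH IH1]; rewrite ?lucasSS /=; try by ring.
by rewrite mulrBr mulrCA IH IH1 !exprS; ring: tt.
Qed.

(** The recurrence for [d] is the differentiated Dickson recurrence. Keeping [d] abstract serves
    both the derivative in one variable and a partial derivative in three. *)
Lemma lucas_D_deriv t u (d : nat -> K) k : t * u = 1 -> d 0%N = 0 -> d 1%N = 1 ->
  (forall k, d k.+2 = lucas (t + u) 2 (t + u) k.+1 + (t + u) * d k.+1 - d k) ->
  (t - u) * d k = k%:R * (t ^+ k - u ^+ k).
Proof.
move=> tu d0 d1 dSS; elim/two_step_ind: k => [||k IH IH1].
- by rewrite d0 mul0r mulr0.
- by rewrite d1 mul1r mulr1.
by rewrite dSS mulrBr mulrDr mulrCA IH IH1 lucas_D // !exprS; ring: tu.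
Qed.

End Lucas.

Lemma rmorph_lucas (K L : comNzRingType) (f : {rmorphism K -> L}) c p q k :
  f (lucas c p q k) = lucas (f c) (f p) (f q) k.
Proof.
rewrite (@lucas_unique L (f c) (fun k => f (lucas c p q k))) // => j.
by rewrite lucasSS rmorphB rmorphM.
Qed.

(** * Two-by-two matrices of determinant one *)

Section Matrices2.
Variable K : fieldType.
Implicit Types (A B M : 'M[K]_2).

Lemma mx2P A B : A 0 0 = B 0 0 -> A 0 1 = B 0 1 -> A 1 0 = B 1 0 ->
  A 1 1 = B 1 1 -> A = B.
Proof.
move=> e00 e01 e10 e11; apply/matrixP => i j.
have o2 (k : 'I_2) : k = 0 \/ k = 1.
  by case: k => [[|[|]]] // h; [left|right]; apply: val_inj.
by case: (o2 i) => ->; case: (o2 j) => ->.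
Qed.

Lemma sum2E (V : nmodType) (F : 'I_2 -> V) : \sum_i F i = F 0 + F 1.
Proof.
by rewrite !big_ord_recl big_ord0 addr0; congr (_ + F _); apply: val_inj.
Qed.

Lemma mulmx2E A B i j : (A *m B) i j = A i 0 * B 0 j + A i 1 * B 1 j.
Proof. by rewrite mxE sum2E. Qed.

Lemma mxtrace2 A : \tr A = A 0 0 + A 1 1.
Proof. exact: sum2E. Qed.

Lemma det_mx22 A : \det A = A 0 0 * A 1 1 - A 0 1 * A 1 0.
Proof.
rewrite (expand_det_row _ 0) sum2E /cofactor !det_mx11 !mxE /=.
rewrite expr0 mul1r expr1 mulN1r mulrN.
by congr (_ * A _ _ - A _ _ * A _ _); apply: val_inj.
Qed.

Lemma Cayley_Hamilton2 A : A *m A = \tr A *: A - \det A *: 1%:M.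
Proof.
by apply: mx2P; rewrite mulmx2E !mxE mxtrace2 det_mx22 /=; ring.
Qed.

(** The polarised form of Cayley-Hamilton; it allows [BA] to be rewritten in terms of [1], [A], [B]
    and [AB]. *)
Lemma anticommutator2 A B :
  A *m B + B *m A =
  \tr A *: B + \tr B *: A + (\tr (A *m B) - \tr A * \tr B) *: 1%:M.
Proof.
by apply: mx2P; rewrite !mxtrace2 !mxE !sum2E /=; ring.
Qed.

Lemma invmx_det1 A : \det A = 1 -> invmx A = \tr A *: 1%:M - A.
Proof.
move=> dA; have uA : A \in unitmx by rewrite unitmxE dA unitr1.
rewrite -[RHS](mulKmx uA) mulmxBr Cayley_Hamilton2 dA scale1r -scalemxAr mulmx1.
by rewrite opprB addrC subrK mulmx1.
Qed.

Lemma expmx_det1 A k : \det A = 1 ->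
  A ^+ k.+1 = lucas (\tr A) 0 1 k.+1 *: A - lucas (\tr A) 0 1 k *: 1.
Proof.
move=> dA; elim: k => [|k IH]; first by rewrite expr1 /= scale0r subr0 scale1r.
rewrite exprS IH mulrBr -!scalerAr mulr1 -[A * A]/(A *m A) Cayley_Hamilton2 dA.
rewrite scale1r lucasSS scalerBl scalerBr scalerA -!addrA; congr (_ + _).
  by rewrite mulrC.
by rewrite addrC.
Qed.

(** Cayley-Hamilton multiplied by a power of [A] and by [M] is, after taking traces, the recurrence
    with coefficient [\tr A]. *)
Lemma mxtrace_expmx_mul A M k : \det A = 1 ->
  \tr (A ^+ k * M) = lucas (\tr A) (\tr M) (\tr (A *m M)) k.
Proof.
move=> dA; rewrite (@lucas_unique _ (\tr A) (fun k => \tr (A ^+ k * M))).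
  by rewrite expr0 mul1r expr1.
move=> j; rewrite !exprSr -!mulrA [A * (A * M)]mulrA -[A * A]/(A *m A).
rewrite Cayley_Hamilton2 dA scale1r mulrBl mulrBr mul1r -scalerAl -scalerAr.
by rewrite mxtraceD raddfN mxtraceZ.
Qed.

Lemma mxtrace_expmx A k : \det A = 1 -> \tr (A ^+ k) = lucas (\tr A) 2 (\tr A) k.
Proof.
by move=> dA; rewrite -[A ^+ k]mulr1 mxtrace_expmx_mul // mulmx1 mxtrace1.
Qed.

(** The characteristic equation is [c^2 - c \tr A + 1 = 0]; its constant term makes [c]
    invertible. *)
Lemma eigenvalue_det1 A (v : 'cV[K]_2) c : \det A = 1 -> v != 0 ->
  A *m v = c *: v -> c != 0 /\ \tr A = c + c^-1.
Proof.
move=> dA v0 Av.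
have : \det (A - c%:M) == 0.
  rewrite -det_tr; apply/det0P; exists v^T; first by rewrite trmx_eq0.
  by rewrite -trmx_mul mulmxBl Av mul_scalar_mx subrr trmx0.
rewrite det_mx22 !mxE /= !mulr1n !mulr0n !subr0.
have := dA; rewrite det_mx22 => dA2 /eqP e.
have {e} e : c * \tr A = c * c + 1.
  by rewrite -dA2 mxtrace2; apply/eqP; rewrite -subr_eq0 -oppr_eq0 -[X in _ == X]e; apply/eqP; ring.
have c0 : c != 0.
  by apply/eqP => c0; move/eqP: e; rewrite c0 !mul0r add0r eq_sym oner_eq0.
split=> //; apply: (mulfI c0); rewrite e mulrDr divff //.
Qed.

Lemma expmx_eigen A (v : 'cV[K]_2) c k : A *m v = c *: v -> A ^+ k *m v = c ^+ k *: v.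
Proof.
move=> Av; elim: k => [|k IH]; first by rewrite !expr0 mul1mx scale1r.
by rewrite exprSr -mulmxA Av -scalemxAr IH scalerA mulrC exprSr.
Qed.

(** The coefficient of [A] in [expmx_det1] vanishes by [lucas_U], which leaves a scalar matrix
    without diagonalising [A]. *)
Lemma expmx_scalar A a m : (0 < m)%N -> \det A = 1 -> \tr A = a + a^-1 -> a != 0 ->
  a - a^-1 != 0 -> a ^+ m = a^-1 ^+ m -> A ^+ m = a ^+ m *: 1.
Proof.
case: m => // m _ dA trA a0 aV e; rewrite expmx_det1 // trA.
have aK : a * a^-1 = 1 by rewrite divff.
have -> : lucas (a + a^-1) 0 1 m.+1 = 0.
  by apply: (mulfI aV); rewrite lucas_U // e subrr mulr0.
rewrite scale0r sub0r -scaleNr; congr (_ *: _); apply: (mulfI aV).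
rewrite mulrN lucas_U // mulrBl opprB; congr (_ - _).
  by rewrite e exprS mulrA aK mul1r.
by rewrite exprS mulrA mulVf // mul1r.
Qed.

End Matrices2.

(** [common_eigenvector] concerns row vectors, hence the transposes. *)
Lemma commuting_common_eigenvector (K : numClosedFieldType) (A B : 'M[K]_2) :
  A *m B = B *m A ->
  exists2 v : 'cV[K]_2, v != 0 & exists a b, A *m v = a *: v /\ B *m v = b *: v.
Proof.
move=> AB; have [||v v0 /and3P[/sub_rVP[a Av] /sub_rVP[b Bv] _]] :=
  @common_eigenvector K 2 [:: A^T; B^T].
- by [].
- move=> X Y; rewrite !inE => /orP[] /eqP-> /orP[] /eqP->;
    by rewrite /comm_mx -?trmx_mul ?AB.
exists v^T; first by rewrite trmx_eq0.
exists a, b; split; apply: trmx_inj; rewrite trmx_mul trmxK.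
  by rewrite Av linearZ /= trmxK.
by rewrite Bv linearZ /= trmxK.
Qed.

(** * The roots of unity exp(pi i k/m) and the map from [a] to [a + 1/a] *)

Section RootsOfUnity.
Variable R : realType.
Local Notation C := (complex R).

Lemma expipiD j k m : expipi R (j + k) m = expipi R j m * expipi R k m.
Proof.
rewrite /expipi natrD mulrDr mulrDl trigo.cosD trigo.sinD.
by apply/eqP; rewrite eq_complex /= eqxx /= addrC.
Qed.

Lemma expipi0 m : expipi R 0 m = 1.
Proof. by rewrite /expipi mulr0 mul0r trigo.cos0 trigo.sin0. Qed.

Lemma expipi_exp k m : expipi R k m = expipi R 1 m ^+ k.
Proof.
elim: k => [|k IH]; first by rewrite expipi0.
by rewrite -addn1 expipiD IH addn1 exprSr.
Qed.

Lemma expipi_m m : (0 < m)%N -> expipi R m m = -1.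
Proof.
move=> m0; rewrite /expipi -mulrA divff ?pnatr_eq0 -?lt0n // mulr1.
rewrite trigo.cospi trigo.sinpi.
by apply/eqP; rewrite eq_complex /= oppr0 !eqxx.
Qed.

Lemma expipi_neq1 k m : (0 < k < m)%N -> expipi R k m != 1.
Proof.
move=> /andP[k0 km]; rewrite eq_complex negb_and /=; apply/orP; right.
have m0 : (0 < m)%N by exact: leq_ltn_trans km.
rewrite gt_eqF // trigo.sin_gt0_pi // -mulrA.
rewrite mulr_gt0 ?trigo.pi_gt0 ?divr_gt0 ?ltr0n //=.
by rewrite gtr_pMr ?trigo.pi_gt0 // ltr_pdivrMr ?ltr0n // mul1r ltr_nat.
Qed.

(** The values at [k] and [m - k] have product -1, so the value -1 at [k] would mean the value 1 at
    [m - k]. *)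
Lemma expipi_neqN1 k m : (0 < k < m)%N -> expipi R k m != -1.
Proof.
move=> /andP[k0 km]; apply/eqP => e.
have : expipi R (m - k) m * expipi R k m = -1.
  by rewrite -expipiD subnK ?expipi_m // ?(leq_ltn_trans _ km) // ltnW.
rewrite e mulrN1 => /oppr_inj/eqP; apply/negP.
by rewrite expipi_neq1 // subn_gt0 km ltn_subrL k0 (leq_ltn_trans _ km).
Qed.

(** The [m]-th power is -1, so an exponent between [m] and [2m] reduces to one below [m], where the
    value -1 is excluded. *)
Lemma expipi_prim m : (0 < m)%N -> (m.*2).-primitive_root (expipi R 1 m).
Proof.
move=> m0; have m20 : (0 < m.*2)%N by rewrite double_gt0.
have zm : expipi R 1 m ^+ m = -1 by rewrite -expipi_exp expipi_m.
rewrite /primitive_root_of_unity m20; apply/forallP => [[i im]] /=.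
rewrite unity_rootE; case: (ltngtP i.+1 m.*2) (im) => [im2|//|-> _]; last first.
  by rewrite -addnn exprD zm mulrNN mulr1 eqxx.
move=> _; rewrite ?eqbF_neg.
case: (ltngtP i.+1 m) => [lt|gt|->].
- by rewrite -expipi_exp expipi_neq1.
- rewrite -(subnK (ltnW gt)) exprD zm mulrN1 eqr_oppLR -expipi_exp.
  by rewrite expipi_neqN1 // subn_gt0 gt ltn_subLR ?addnn // ltnW.
by rewrite zm eq_sym -addr_eq0 -[1 + 1]/(2%:R) pnatr_eq0.
Qed.

Lemma expipi_neq0 k m : expipi R k m != 0.
Proof.
have : expipi R k m * expipi R k m ^+ (m.*2.-1) = 1 \/ m = 0%N.
  case: m => [|m]; [by right|left].
  rewrite -exprS prednK ?double_gt0 // expipi_exp -exprM mulnC exprM.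
  by rewrite (prim_expr_order (expipi_prim _)) // expr1n.
move=> [e|->].
  by apply/eqP => z; move/eqP: e; rewrite z mul0r eq_sym oner_eq0.
(* For [m = 0] the inverse of zero is zero, so the angle is 0 and the value is 1. *)
by rewrite /expipi invr0 mulr0 trigo.cos0 trigo.sin0 oner_eq0.
Qed.

Lemma expipi_exp_m k m : (0 < m)%N -> expipi R k m ^+ m = (-1) ^+ odd k.
Proof.
move=> m0; rewrite expipi_exp -exprM mulnC exprM -expipi_exp expipi_m //.
by rewrite signr_odd.
Qed.

Lemma sub_inv_eq0 (a : C) : a != 0 -> (a - a^-1 == 0) = (a == 1) || (a == -1).
Proof.
move=> a0; rewrite -(mulrI_eq0 _ (mulfI a0)) mulrBr divff //.
by rewrite -expr2 subr_sqr_1 mulf_eq0 subr_eq0 addr_eq0.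
Qed.

Lemma expipi_sub_inv k m : (0 < k < m)%N -> expipi R k m - (expipi R k m)^-1 != 0.
Proof.
move=> km; rewrite sub_inv_eq0 ?expipi_neq0 // negb_or.
by rewrite expipi_neq1 // expipi_neqN1.
Qed.

Lemma add_inv_eq (a b : C) : a != 0 -> b != 0 ->
  a + a^-1 = b + b^-1 -> a = b \/ a = b^-1.
Proof.
move=> a0 b0 e.
have : (a - b) * (a - b^-1) == 0.
  have -> : (a - b) * (a - b^-1) = a * (a + a^-1 - (b + b^-1)).
    by field; rewrite a0 b0.
  by rewrite e subrr mulr0.
by rewrite mulf_eq0 !subr_eq0 => /orP[] /eqP; [left|right].
Qed.

(** Equal sums mean equal or inverse roots. Inverse roots would give the value 1 at [j + k], which
    lies strictly between 0 and [2m]. *)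
Lemma expipi_add_inv_inj j k m : (0 < j < m)%N -> (0 < k < m)%N ->
  expipi R j m + (expipi R j m)^-1 = expipi R k m + (expipi R k m)^-1 -> j = k.
Proof.
move=> /andP[j0 jm] /andP[k0 km].
have m0 : (0 < m)%N by exact: leq_ltn_trans jm.
have lt2 i : (i < m)%N -> (i < m.*2)%N.
  by move=> im; rewrite -addnn ltn_addl.
have pr := expipi_prim m0.
move/add_inv_eq => []; rewrite ?expipi_neq0 //.
  move/eqP; rewrite (expipi_exp j) (expipi_exp k) (eq_prim_root_expr pr).
  by rewrite !modn_small ?lt2 // => /eqP.
move=> e; have : expipi R (j + k) m = 1 by rewrite expipiD e mulVf ?expipi_neq0.
move/eqP; rewrite expipi_exp -(prim_order_dvd pr) => /dvdn_leq.
have lt : (j + k < m + m)%N by rewrite -addSn leq_add // ltnW.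
by rewrite addn_gt0 j0 => /(_ isT); rewrite -addnn leqNgt lt.
Qed.

(** Such an [a] is a power of the primitive [2m]-th root with exponent [i] different from 0 and [m];
    when [i > m], inverting replaces it by [2m - i]. *)
Lemma unity_root_expipi (a : C) m : (0 < m)%N -> a != 0 -> a ^+ m = a^-1 ^+ m ->
  a - a^-1 != 0 -> exists2 k, (0 < k < m)%N &
    expipi R k m = a \/ expipi R k m = a^-1.
Proof.
move=> m0 a0 e; rewrite sub_inv_eq0 // negb_or => /andP[a1 aN1].
have a2 : a ^+ m.*2 = 1 by rewrite -addnn exprD {1}e -exprMn mulVf // expr1n.
have [[i im] /= ai] := prim_rootP (expipi_prim m0) a2.
have i0 : (0 < i)%N by rewrite lt0n; apply: contra_neqN a1 => /eqP i0; rewrite ai i0.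
case: (ltngtP i m) => [lt|gt|eq].
- by exists i; [rewrite i0 lt|left; rewrite expipi_exp -ai].
- exists (m.*2 - i)%N; first by rewrite subn_gt0 im -addnn ltn_subLR ?ltn_add2r // addnn ltnW.
  right; apply: (mulIf a0); rewrite mulVf // ai -expipi_exp -expipiD subnK 1?ltnW //.
  by rewrite expipi_exp (prim_expr_order (expipi_prim m0)).
by move: aN1; rewrite ai eq -expipi_exp expipi_m // eqxx.
Qed.

Lemma coprime_root (a b : C) m n : (0 < m)%N -> coprime m n -> a != 0 -> b != 0 ->
  a ^+ m = b ^+ n -> exists2 t, t != 0 & t ^+ n = a /\ t ^+ m = b.
Proof.
move=> m0 /eqP mn a0 b0 e; case: (egcdnP n m0) => km kn; rewrite mn => E _.
(* The Bezout relation is [km * m = kn * n + 1]; combined with [a^m = b^n] it gives both powers of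
   this quotient. *)
exists (b ^+ km / a ^+ kn); first by rewrite mulf_neq0 ?invr_eq0 ?expf_neq0.
split; rewrite expr_div_n -!exprM.
  rewrite [(km * n)%N]mulnC exprM -e -exprM mulnC E addn1 exprS.
  by rewrite mulfK ?expf_neq0.
by rewrite [(kn * m)%N]mulnC (exprM a m) e -exprM E [(n * kn)%N]mulnC addn1 exprS mulfK ?expf_neq0.
Qed.

(** [t] is a root of [X^2 - s X + 1], whose two roots are mutually inverse. *)
Lemma exists_add_inv (s : C) : exists2 t, t != 0 & s = t + t^-1.
Proof.
pose t := (s + sqrtC (s ^+ 2 - 4)) / 2.
have e : t * (s - t) = 1.
  have two0 : (2 : C) != 0 by rewrite pnatr_eq0.
  have -> : t * (s - t) = (s ^+ 2 - sqrtC (s ^+ 2 - 4) ^+ 2) / 4.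
    by rewrite /t; field.
  by rewrite sqrtCK; field.
have t0 : t != 0 by apply/eqP => t0; move/eqP: e; rewrite t0 mul0r eq_sym oner_eq0.
by exists t => //; apply: (mulfI t0); rewrite mulrDr divff // -e; ring.
Qed.

End RootsOfUnity.

(** * Counting the pairs of indices of equal parity *)

Lemma card_set_ord (m : nat) (P : pred nat) :
  #|[set i : 'I_m | P i]| = (\sum_(i < m) P i)%N.
Proof.
by rewrite -sum1dep_card big_mkcond; apply: eq_bigr => i _; case: (P i).
Qed.

Lemma sum_odd_half m : (\sum_(i < m) odd i)%N = m./2.
Proof.
elim: m => [|m IH]; first by rewrite big_ord0.
by rewrite big_ord_recr IH /= uphalf_half addnC.
Qed.

Lemma sum_even_half m : (\sum_(i < m) ((0 < i) && ~~ odd i))%N = m.-1./2.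
Proof.
elim: m => [|m IH]; first by rewrite big_ord0.
rewrite big_ord_recr IH /=; case: m {IH} => //= m.
by rewrite negbK uphalf_half addnC.
Qed.

Lemma half_add_half_pred n : (n./2 + n.-1./2)%N = n.-1.
Proof.
by case: n => //= n; rewrite uphalf_half -addnA addnn odd_double_half.
Qed.

(** The odd-odd and even-even pairs are counted separately. Coprimality makes one of [m], [n] odd;
    for that one both halves agree, and the halves of the other add up to its predecessor. *)
Lemma card_Kset m n : (0 < m)%N -> (0 < n)%N -> coprime m n ->
  #|Kset m n| = ((m.-1 * n.-1) %/ 2)%N.
Proof.
move=> m0 n0 mn.
pose od k := [set i : 'I_k | odd i]; pose ev k := [set i : 'I_k | (0 < i)%N && ~~ odd i].
have -> : Kset m n = setX (od m) (od n) :|: setX (ev m) (ev n).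
  apply/setP => [[i j]]; rewrite !inE /=.
  case: (posnP i) => [->|_] //=; case: (posnP j) => [->|_] //=; last first.
    by case: (odd i); case: (odd j).
  by rewrite !andbF.
rewrite cardsU !cardsX.
have -> : setX (od m) (od n) :&: setX (ev m) (ev n) = set0.
  by apply/setP => [[i j]]; rewrite !inE /=; case: (odd i); rewrite ?andbF.
rewrite cards0 subn0 !(card_set_ord _ odd) !sum_odd_half.
rewrite !(card_set_ord _ (fun i => (0 < i)%N && ~~ odd i)) !sum_even_half.
have odd_case k l : (0 < k)%N -> odd k ->
    (k./2 * l./2 + k.-1./2 * l.-1./2 = (k.-1 * l.-1) %/ 2)%N.
  case: k => // k _ /= ek; rewrite uphalf_half (negPf ek) add0n -mulnDr.
  rewrite half_add_half_pred -{2}[k]odd_double_half (negPf ek) add0n.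
  by rewrite -muln2 mulnAC mulnK.
case: (boolP (odd m)) => [|em]; first exact: odd_case.
rewrite [(m./2 * _)%N]mulnC [(m.-1./2 * _)%N]mulnC [(m.-1 * _)%N]mulnC.
apply: odd_case => //; apply: contraTT mn => en; rewrite /coprime.
apply/eqP => mn1.
by have := dvdn_gcd 2 m n; rewrite mn1 !dvdn2 em en.
Qed.

(** * Traces of words as polynomials in three coordinates, and traces of the explicit diagonal and
    conjugated pairs *)

Section Fricke.
Variable R : realType.
Local Notation C := (complex R).
Local Notation M2 := 'M[C]_2.
Implicit Types A B : M2.

Definition i0 : 'I_3 := @Ordinal 3 0 isT.
Definition i1 : 'I_3 := @Ordinal 3 1 isT.
Definition i2 : 'I_3 := @Ordinal 3 2 isT.

Lemma ord3P (P : 'I_3 -> Prop) : P i0 -> P i1 -> P i2 -> forall i, P i.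
Proof.
move=> P0 P1 P2 [[|[|[|//]]] h]; [move: P0|move: P1|move: P2];
  by congr P; apply: val_inj.
Qed.

Lemma sum3E (V : nmodType) (F : 'I_3 -> V) : \sum_i F i = F i0 + F i1 + F i2.
Proof.
rewrite !big_ord_recl big_ord0 addr0 addrA.
by congr (F _ + F _ + F _); apply: val_inj.
Qed.

Definition trace_pt A B : pt R :=
  \row_(i < 3) [:: \tr A; \tr B; \tr (A *m B)]`_i.

Lemma trace_ptE A B : (trace_pt A B ord0 i0 = \tr A) *
  (trace_pt A B ord0 i1 = \tr B) * (trace_pt A B ord0 i2 = \tr (A *m B)).
Proof. by rewrite !mxE. Qed.

Lemma Psi_character A B : Psi (character A B) = trace_pt A B.
Proof. by apply/rowP; apply: ord3P; rewrite !mxE /character /= !mulmx1. Qed.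

(** The span of [1], [A], [B], [AB] over polynomials in the trace coordinates; the quantifier order
    makes the polynomials the same for all pairs. Left multiplication by any letter preserves it. *)
Definition fricke_span (F : M2 -> M2 -> M2) : Prop :=
  exists p q r s : {mpoly C[3]}, forall A B, \det A = 1 -> \det B = 1 ->
    F A B = evp p (trace_pt A B) *: 1%:M + evp q (trace_pt A B) *: A
            + evp r (trace_pt A B) *: B + evp s (trace_pt A B) *: (A *m B).

Lemma fricke_span_mull F : fricke_span F -> fricke_span (fun A B => A *m F A B).
Proof.
move=> [p [q [r [s FE]]]].
exists (- q), (p + 'X_i0 * q), (- s), (r + 'X_i0 * s) => A B dA dB.
rewrite FE // !mulmxDr -!scalemxAr mulmxA mulmx1 Cayley_Hamilton2 dA scale1r.
rewrite mulmxBl mul1mx -scalemxAl /evp !mevalD !mevalM !mevalN !mevalXU.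
rewrite [trace_pt A B ord0 i0]mxE /=.
move: (trace_pt A B) (A *m B) (1%:M : M2) => x AB I.
by apply/matrixP => i j; rewrite !mxE; ring.
Qed.

Lemma fricke_span_mulr F : fricke_span F -> fricke_span (fun A B => B *m F A B).
Proof.
move=> [p [q [r [s FE]]]].
(* With traces [x, y, z] of [A], [B], [AB]: [BA = (z - xy) + yA + xB - AB], [BB = yB - 1] and
   [BAB = -x + A + zB]. *)
exists (q * ('X_i2 - 'X_i0 * 'X_i1) - r - s * 'X_i0), (q * 'X_i1 + s),
  (p + q * 'X_i0 + r * 'X_i1 + s * 'X_i2), (- q) => A B dA dB.
have BA : B *m A = \tr A *: B + \tr B *: A
    + (\tr (A *m B) - \tr A * \tr B) *: 1%:M - A *m B.
  by rewrite -anticommutator2 addrC addKr.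
rewrite FE // !mulmxDr -!scalemxAr mulmxA mulmx1 BA.
rewrite mulmxBl !mulmxDl -!scalemxAl mul1mx -mulmxA !Cayley_Hamilton2 dB scale1r.
rewrite mulmxBr mulmx1 -scalemxAr.
rewrite /evp !(mevalD, mevalM, mevalB, mevalN, mevalXU) ![trace_pt A B ord0 _]mxE /=.
move: (trace_pt A B) (A *m B) (1%:M : M2) => x AB I.
by apply/matrixP => i j; rewrite !mxE; ring.
Qed.

(** Handles the inverse letters, since the inverse of [A] is [\tr A - A] in determinant one. *)
Lemma fricke_spanZB (f : {mpoly C[3]}) F G : fricke_span F -> fricke_span G ->
  fricke_span (fun A B => evp f (trace_pt A B) *: F A B - G A B).
Proof.
move=> [p [q [r [s FE]]]] [p' [q' [r' [s' GE]]]].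
exists (f * p - p'), (f * q - q'), (f * r - r'), (f * s - s') => A B dA dB.
rewrite FE // GE // !evpB !evpM.
move: (trace_pt A B) (A *m B) (1%:M : M2) => x AB I.
by apply/matrixP => i j; rewrite !mxE; ring.
Qed.

Lemma fricke_span_ext F G :
  (forall A B, \det A = 1 -> \det B = 1 -> F A B = G A B) ->
  fricke_span F -> fricke_span G.
Proof.
move=> FG [p [q [r [s FE]]]]; exists p, q, r, s => A B dA dB.
by rewrite -FG // FE.
Qed.

Lemma fricke_span_word w : fricke_span (fun A B => word_mx A B w).
Proof.
elim: w => [|l w IH].
  exists 1, 0, 0, 0 => A B _ _.
  by rewrite /evp meval1 !meval0 scale1r !scale0r !addr0.
case: l; [exact: fricke_span_mull| |exact: fricke_span_mulr|].
  apply: (fricke_span_ext _ (fricke_spanZB 'X_i0 IH (fricke_span_mull IH))).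
  move=> A B dA dB; rewrite evpX mxE /= invmx_det1 // mulmxBl.
  by rewrite -scalemxAl mul1mx.
apply: (fricke_span_ext _ (fricke_spanZB 'X_i1 IH (fricke_span_mulr IH))).
move=> A B dA dB; rewrite evpX mxE /= invmx_det1 // mulmxBl.
by rewrite -scalemxAl mul1mx.
Qed.

Lemma fricke_polynomial w : exists f : {mpoly C[3]}, forall A B,
  \det A = 1 -> \det B = 1 -> character A B w = evp f (trace_pt A B).
Proof.
have [p [q [r [s wE]]]] := fricke_span_word w.
exists (p * 2%:R + q * 'X_i0 + r * 'X_i1 + s * 'X_i2) => A B dA dB.
rewrite /character wE // !mxtraceD !mxtraceZ mxtrace1 !evpD !evpM !evpX.
by rewrite /evp rmorph_nat !mxE.
Qed.

Lemma diag2E (a : C) i j : diag2 a i j = if i == j then (if i == 0 then a else a^-1) else 0.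
Proof.
rewrite !mxE; case: eqP => [->|]; rewrite ?mulr0n // mulr1n.
by case: j => [[|[|]]].
Qed.

Lemma diag2M (a b : C) : diag2 a *m diag2 b = diag2 (a * b).
Proof.
by apply: mx2P; rewrite mulmx2E !diag2E /= ?invfM; ring.
Qed.

Lemma diag2_1 : diag2 (1 : C) = 1%:M.
Proof. by apply: mx2P; rewrite diag2E mxE /= ?invr1. Qed.

Lemma diag2X (a : C) k : diag2 a ^+ k = diag2 (a ^+ k).
Proof.
elim: k => [|k IH]; first by rewrite !expr0 diag2_1.
by rewrite !exprS IH -[_ * _]/(_ *m _) diag2M.
Qed.

Lemma det_diag2 (a : C) : a != 0 -> \det (diag2 a) = 1.
Proof. by move=> a0; rewrite det_mx22 !diag2E /= mulr0 subr0 divff. Qed.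

Lemma mxtrace_diag2 (a : C) : \tr (diag2 a) = a + a^-1.
Proof. by rewrite mxtrace2 !diag2E. Qed.

Lemma diag2V (a : C) : a != 0 -> invmx (diag2 a) = diag2 a^-1.
Proof.
move=> a0; rewrite invmx_det1 ?det_diag2 // mxtrace_diag2.
by apply: mx2P; rewrite diag2E !mxE /= ?invrK; ring.
Qed.

Lemma trace_pt_diag2 (a b : C) : trace_pt (diag2 a) (diag2 b) =
  \row_(i < 3) [:: a + a^-1; b + b^-1; a * b + (a * b)^-1]`_i.
Proof. by apply/rowP; apply: ord3P; rewrite !mxE /= ?diag2M mxtrace_diag2. Qed.

(** The matrix of the word [y^j x^-k], whose trace recovers the parameter of the reducible curve for
    Bezout exponents. *)
Lemma word_mx_diag2 (a b : C) j k : a != 0 ->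
  word_mx (diag2 a) (diag2 b) (nseq j Ly ++ nseq k Lxi) = diag2 (b ^+ j / a ^+ k).
Proof.
move=> a0; elim: j => [|j IH] /=; last by rewrite IH diag2M exprS mulrA.
rewrite expr0 mul1r; elim: k => [|k IH] /=; first by rewrite invr1 diag2_1.
by rewrite IH diag2V // diag2M exprS invfM.
Qed.

Lemma det_Pmat (r : C) : \det (Pmat r) = 1.
Proof. by rewrite det_mx22 !mxE /=; ring. Qed.

(** The trace is affine in [r], with slope nonzero as soon as neither [a] nor [b] equals its
    inverse. *)
Lemma mxtrace_irr (a b r : C) :
  \tr (diag2 a *m (Pmat r *m diag2 b *m invmx (Pmat r))) =
  a * b^-1 + a^-1 * b + r * ((a - a^-1) * (b - b^-1)).
Proof.
rewrite invmx_det1 ?det_Pmat // !mxtrace2 !mulmx2E !diag2E !mxE /=.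
by ring.
Qed.

End Fricke.

(** * The components of the character curve and their intersections *)

Section TorusKnot.
Variables (R : realType) (m n : nat).
Hypotheses (m0 : (0 < m)%N) (n0 : (0 < n)%N) (mn : coprime m n).
Local Notation C := (complex R).
Local Notation e k m := (expipi R k m).
Implicit Types (A B : 'M[C]_2) (p : pt R).

Definition red_pt (a b : C) : pt R :=
  \row_(i < 3) [:: a + a^-1; b + b^-1; a * b + (a * b)^-1]`_i.

(** The common eigenvector has eigenvalue [ab] under [AB], and determinant one then fixes all three
    traces; applying [A^m = B^n] to it relates [a] and [b]. *)
Lemma reducible_trace_pt A B : torus_rep m n A B -> reducible A B ->
  exists a b, [/\ a != 0, b != 0, a ^+ m = b ^+ n & trace_pt A B = red_pt a b].
Proof.
move=> [dA [dB AB]] [v [v0 [a [b [Av Bv]]]]]; exists a, b.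
have [a0 trA] := eigenvalue_det1 dA v0 Av.
have [b0 trB] := eigenvalue_det1 dB v0 Bv.
have ABv : (A *m B) *m v = (a * b) *: v.
  by rewrite -mulmxA Bv -scalemxAr Av scalerA mulrC.
have [|_ trAB] := eigenvalue_det1 _ v0 ABv; first by rewrite det_mulmx dA dB mulr1.
split=> //; last by rewrite /trace_pt trA trB trAB.
have /eqP := congr1 (fun M : 'M_2 => M *m v) AB.
rewrite (expmx_eigen _ Av) (expmx_eigen _ Bv) -subr_eq0 -scalerBl scaler_eq0.
by rewrite (negPf v0) orbF subr_eq0 => /eqP.
Qed.

Lemma CredP p : Cred R m n p <->
  exists a b, [/\ a != 0, b != 0, a ^+ m = b ^+ n & p = red_pt a b].
Proof.
split=> [[chi [[A [B [AB rAB ->]]] ->]]|[a [b [a0 b0 ab ->]]]].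
  by rewrite Psi_character; exact: reducible_trace_pt.
exists (character (diag2 a) (diag2 b)); split; last first.
  by rewrite Psi_character trace_pt_diag2.
exists (diag2 a), (diag2 b); split=> //.
  by split; [|split]; rewrite ?det_diag2 // !diag2X ab.
exists (\col_(i < 2) (i == 0)%:R); split.
  by apply/eqP => /colP/(_ 0); rewrite !mxE /= => /eqP; rewrite oner_eq0.
have diag2_e0 (c : C) :
    diag2 c *m \col_(i < 2) (i == 0)%:R = c *: \col_(i < 2) (i == 0)%:R.
  apply/matrixP => i j; rewrite !mxE sum2E !diag2E !mxE /= mulr1 mulr0 addr0.
  by case: eqP => _; rewrite ?mulr1 ?mulr0.
by exists a, b; split; exact: diag2_e0.
Qed.

(** The Dickson polynomial sending [t + 1/t] to [t^k + t^-k]. *)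
Definition dickson (k : nat) : {poly C} := lucas 'X 2%:R 'X k.

Definition red_param (i : 'I_3) : {poly C} :=
  [:: dickson n; dickson m; dickson (m + n)]`_i.

Lemma horner_dickson k s : (dickson k).[s] = lucas s 2 s k.
Proof.
by rewrite -horner_evalE rmorph_lucas /= !horner_evalE hornerX -polyC_natr hornerC.
Qed.

Lemma deriv_dickson k (t : C) : t != 0 ->
  (t - t^-1) * (dickson k)^`().[t + t^-1] = k%:R * (t ^+ k - t^-1 ^+ k).
Proof.
move=> t0; apply: (lucas_D_deriv (d := fun k => (dickson k)^`().[t + t^-1])).
- by rewrite divff.
- by rewrite /dickson /= -polyC_natr derivC horner0.
- by rewrite /dickson /= derivX hornerC.
move=> j; rewrite /dickson lucasSS derivB derivM derivX mul1r !hornerE.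
by rewrite horner_dickson.
Qed.

Lemma red_paramE (t : C) : t != 0 ->
  polymap red_param (t + t^-1) = red_pt (t ^+ n) (t ^+ m).
Proof.
move=> t0; have tV : t * t^-1 = 1 by rewrite divff.
apply/rowP; apply: ord3P; rewrite !mxE /red_param /= horner_dickson lucas_D //.
- by rewrite exprVn.
- by rewrite exprVn.
by rewrite -exprD addnC exprVn.
Qed.

Lemma red_param_Cred s : Cred R m n (polymap red_param s).
Proof.
have [t t0 ->] := exists_add_inv s; apply/CredP; exists (t ^+ n), (t ^+ m).
by rewrite red_paramE // !expf_neq0 // -!exprM mulnC.
Qed.

Lemma Cred_red_param p : Cred R m n p ->
  exists2 t, t != 0 & p = polymap red_param (t + t^-1).
Proof.
move=> /CredP[a [b [a0 b0 ab ->]]].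
have [t t0 [<- <-]] := coprime_root m0 mn a0 b0 ab.
by exists t; rewrite ?red_paramE.
Qed.

(* t + 1/t is the trace of x^u y^v with u n + v m = 1, hence a polynomial in
   the three coordinates. *)
Lemma red_param_inverse : exists psi : {mpoly C[3]},
  forall s, evp psi (polymap red_param s) = s.
Proof.
case: (egcdnP n m0) => km kn; rewrite (eqP mn) => E _.
have [psi psiE] := fricke_polynomial R (nseq km Ly ++ nseq kn Lxi).
exists psi => s; have [t t0 ->] := exists_add_inv s.
rewrite red_paramE // -[red_pt _ _]trace_pt_diag2.
rewrite -psiE ?det_diag2 ?expf_neq0 // /character word_mx_diag2 ?expf_neq0 //.
rewrite mxtrace_diag2 -!exprM [(m * km)%N]mulnC E [(n * kn)%N]mulnC addn1 exprS.
by rewrite mulfK ?expf_neq0.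
Qed.

Definition irr_param (x y : C) (i : 'I_3) : {poly C} := [:: x%:P; y%:P; 'X]`_i.

Definition cos2 k j : C := e k j + (e k j)^-1.

Lemma CirrP k k' p : (0 < k < m)%N -> (0 < k' < n)%N ->
  Cirr R m n k k' p <-> p ord0 i0 = cos2 k m /\ p ord0 i1 = cos2 k' n.
Proof.
move=> km kn.
have uP (r : C) : Pmat r \in unitmx by rewrite unitmxE det_Pmat unitr1.
have PsiE r : Psi (character (diag2 (e k m))
    (Pmat r *m diag2 (e k' n) *m invmx (Pmat r))) =
  \row_(i < 3) [:: cos2 k m; cos2 k' n;
    e k m * (e k' n)^-1 + (e k m)^-1 * e k' n +
    r * ((e k m - (e k m)^-1) * (e k' n - (e k' n)^-1))]`_i.
  rewrite Psi_character /trace_pt mxtrace_irr mxtrace_diag2.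
  by rewrite mxtrace_mulC mulmxA mulVmx ?mul1mx ?mxtrace_diag2.
split=> [[chi [[r ->] ->]]|[p0 p1]]; first by rewrite PsiE !mxE.
set c0 := e k m * (e k' n)^-1 + (e k m)^-1 * e k' n.
set c1 := (e k m - (e k m)^-1) * (e k' n - (e k' n)^-1).
(* The third coordinate is [c0 + r c1]; a nonzero slope lets [r] be solved for, so the image is the
   whole vertical line. *)
have c10 : c1 != 0 by rewrite mulf_neq0 ?expipi_sub_inv.
set r := (p ord0 i2 - c0) / c1.
exists (character (diag2 (e k m)) (Pmat r *m diag2 (e k' n) *m invmx (Pmat r))).
split; first by exists r.
rewrite PsiE; apply/rowP; apply: ord3P; rewrite !mxE //=.
by rewrite -/c0 -/c1 /r divfK // addrC subrK.
Qed.

Lemma irr_param_Cirr k k' t : (0 < k < m)%N -> (0 < k' < n)%N ->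
  Cirr R m n k k' (polymap (irr_param (cos2 k m) (cos2 k' n)) t).
Proof.
by move=> km kn; apply/CirrP => //; rewrite !mxE /irr_param /= !hornerC.
Qed.

Lemma irr_paramK (x y t : C) : evp 'X_i2 (polymap (irr_param x y) t) = t.
Proof. by rewrite evpX mxE hornerX. Qed.

Lemma Cirr_irr_param k k' p : (0 < k < m)%N -> (0 < k' < n)%N ->
  Cirr R m n k k' p ->
  polymap (irr_param (cos2 k m) (cos2 k' n)) (evp 'X_i2 p) = p.
Proof.
move=> km kn /(CirrP _ km kn) [p0 p1].
apply/rowP; apply: ord3P; rewrite mxE /irr_param /= ?hornerC ?hornerX //.
by rewrite evpX.
Qed.

Lemma irr_velocity (x y t : C) :
  velocity (irr_param x y) t = \row_(i < 3) [:: 0; 0; 1]`_i.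
Proof.
by apply/rowP; apply: ord3P; rewrite !mxE /irr_param /= ?derivC ?derivX hornerC.
Qed.

Lemma commuting_reducible A B : A *m B = B *m A -> reducible A B.
Proof. by move/commuting_common_eigenvector => [v v0 ab]; exists v. Qed.

Lemma noncommuting_trace A B j : (0 < j)%N -> \det A = 1 ->
  A ^+ j *m B = B *m A ^+ j -> A *m B <> B *m A ->
  exists2 k, (0 < k < j)%N & \tr A = cos2 k j.
Proof.
case: j => // j _ dA comm nAB.
have U0 : lucas (\tr A) 0 1 j.+1 = 0.
  apply/eqP; apply/negPn/negP => U0; apply: nAB; apply: (scalerI U0).
  move: comm; rewrite expmx_det1 // mulmxBl mulmxBr -!scalemxAl -!scalemxAr.
  by rewrite mul1mx mulmx1 => /addIr.
have [a a0 trA] := exists_add_inv (\tr A); rewrite trA in U0.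
have aV : a * a^-1 = 1 by rewrite divff.
have ne : a - a^-1 != 0.
  (* If [a = 1/a], then [lucas_U_double] would give [j.+1 * a^(j.+1) = 0], impossible in
     characteristic zero. *)
  apply/eqP => /eqP; rewrite subr_eq0 => /eqP ae.
  have := lucas_U_double j.+1 (t := a); rewrite {2 5}ae U0 mulr0 => /(_ aV)/esym/eqP.
  by rewrite mulf_eq0 pnatr_eq0 /= expf_eq0 /= (negPf a0).
have ae : a ^+ j.+1 = a^-1 ^+ j.+1.
  by apply/eqP; rewrite -subr_eq0 -lucas_U // U0 mulr0.
have [//|k kj ek] := unity_root_expipi _ a0 ae ne; exists k => //.
by rewrite trA /cos2; case: ek => ->; rewrite ?invrK // addrC.
Qed.

(** The sign depends on the parity of [k], which is the origin of the condition that [k] and [k']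
    have equal parity. *)
Lemma expmx_cos2 A k j : (0 < k < j)%N -> \det A = 1 -> \tr A = cos2 k j ->
  A ^+ j = (-1) ^+ odd k *: 1.
Proof.
move=> kj dA trA; have j0 : (0 < j)%N by case/andP: kj => _; exact: leq_ltn_trans.
rewrite -(expipi_exp_m R k j0) (expmx_scalar j0 dA trA) ?expipi_neq0 ?expipi_sub_inv //.
by rewrite exprVn expipi_exp_m // -exprVn invrN1.
Qed.

Lemma Kset_bounds kk : kk \in Kset m n ->
  [/\ (0 < kk.1 < m)%N, (0 < kk.2 < n)%N & odd kk.1 = odd kk.2].
Proof.
by rewrite inE => /and3P[k0 k0' /eqP o]; split=> //; rewrite ?k0 ?k0' /=.
Qed.

(** A single index type for all components: [None] for the reducible one, so that the lemmas on
    finite unions apply. *)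
Definition branch (o : option ('I_m * 'I_n)) : pt R -> Prop :=
  if o is Some kk then Cirr R m n kk.1 kk.2 else Cred R m n.

Definition branches := None :: [seq Some kk | kk <- enum (Kset m n)].

Lemma Some_branches kk : (Some kk \in branches) = (kk \in Kset m n).
Proof. by rewrite inE /= mem_map ?mem_enum // => x y []. Qed.

(** The split is on commutation rather than reducibility. Noncommuting reducible pairs therefore
    land on the vertical lines, which is harmless because the union need not be disjoint. *)
Lemma Ccurve_branches :
  seteq_pt (Ccurve R m n) (fun p => exists2 o, o \in branches & branch o p).
Proof.
move=> p; split.
  move=> [chi [[A [B [AB ->]]] ->]]; have [dA [dB ABe]] := AB.
  have [cAB|/eqP nAB] := eqVneq (A *m B) (B *m A).
    exists None => //=; exists (character A B); split=> //.
    by exists A, B; split=> //; exact: commuting_reducible.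
  have [|k km trA] := noncommuting_trace m0 dA _ nAB.
    by rewrite ABe -[LHS]exprSr -[RHS]exprS.
  have [||k' kn trB] := noncommuting_trace n0 dB (B := A); last 1 first.
  - have [k1 km1] := andP km; have [k2 kn2] := andP kn.
    exists (Some (Ordinal km1, Ordinal kn2)).
      rewrite Some_branches inE /= k1 k2 /=.
      (* Both powers are scalars with sign given by parity, so their equality forces equal
         parities. *)
      move: ABe; rewrite (expmx_cos2 km dA trA) (expmx_cos2 kn dB trB).
      move=> /matrixP/(_ 0 0); rewrite !mxE /= !mulr1.
      case: (odd k); case: (odd k') => //= /eqP; rewrite ?expr0 ?expr1.
        by rewrite eq_sym -addr_eq0 -[1 + 1]/(2%:R) pnatr_eq0.
      by rewrite -addr_eq0 -[1 + 1]/(2%:R) pnatr_eq0.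
    by apply/CirrP => //; rewrite Psi_character !mxE.
  - by rewrite -ABe -[LHS]exprSr -[RHS]exprS.
  by move=> /esym.
move=> [[kk|] /= ob]; last first.
  by move=> [chi [[A [B [AB _ ->]]] ->]]; exists (character A B); split=> //; exists A, B.
move: ob; rewrite Some_branches => /Kset_bounds[km kn o] [chi [[r ->] ->]].
set A := diag2 _; set B := _ *m _ *m _; exists (character A B); split=> //.
exists A, B; split=> //.
have uP : Pmat r \in unitmx by rewrite unitmxE (det_Pmat (r : C)) unitr1.
have dA : \det A = 1 by rewrite det_diag2 ?expipi_neq0.
have dB : \det B = 1.
  by rewrite !det_mulmx det_inv det_diag2 ?expipi_neq0 // det_Pmat invr1 !mulr1.
have trA : \tr A = cos2 kk.1 m by rewrite mxtrace_diag2.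
have trB : \tr B = cos2 kk.2 n.
  by rewrite mxtrace_mulC mulmxA mulVmx // mul1mx mxtrace_diag2.
by split=> //; split=> //; rewrite (expmx_cos2 km dA trA) (expmx_cos2 kn dB trB) o.
Qed.

Lemma red_pt_roots (a b : C) k k' : a != 0 -> b != 0 ->
  Cirr R m n k k' (red_pt a b) -> (0 < k < m)%N -> (0 < k' < n)%N ->
  (a = e k m \/ a = (e k m)^-1) /\ (b = e k' n \/ b = (e k' n)^-1).
Proof.
move=> a0 b0 ab km kn; move/(CirrP _ km kn): ab; rewrite !mxE /= => -[ea eb].
by split; apply: add_inv_eq; rewrite ?expipi_neq0.
Qed.

(** The first two coordinates fix [a] and [b] up to separate inversion; simultaneous inversion does
    not move the point, so two of the four choices remain. Equal parity puts both on the reducible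
    curve. *)
Lemma Cred_Cirr kk p : kk \in Kset m n ->
  (Cred R m n p /\ Cirr R m n kk.1 kk.2 p) <->
  p = red_pt (e kk.1 m) (e kk.2 n) \/ p = red_pt (e kk.1 m) (e kk.2 n)^-1.
Proof.
move=> /Kset_bounds[km kn o]; split.
  move=> [/CredP[a [b [a0 b0 _ ->]]] ab].
  have [[->|->] [->|->]] := red_pt_roots a0 b0 ab km kn; [left|right|right|left];
    apply/rowP; apply: ord3P; rewrite !mxE /= ?invfM ?invrK //;
    by rewrite ?[_^-1 + _]addrC // [LHS]addrC.
have lm : e kk.1 m ^+ m = e kk.2 n ^+ n by rewrite !expipi_exp_m // o.
have lmV : e kk.1 m ^+ m = (e kk.2 n)^-1 ^+ n.
  by rewrite exprVn -lm expipi_exp_m // -exprVn invrN1.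
move=> [] ->; split.
- by apply/CredP; exists (e kk.1 m), (e kk.2 n); rewrite !expipi_neq0.
- by apply/CirrP; rewrite ?mxE.
- by apply/CredP; exists (e kk.1 m), (e kk.2 n)^-1; rewrite invr_eq0 !expipi_neq0.
- by apply/CirrP; rewrite ?mxE /= ?invrK // [_^-1 + _]addrC.
Qed.

(** The third coordinates differ by [(a - 1/a)(b - 1/b)], a product of nonzero factors. *)
Lemma nodes_distinct kk : kk \in Kset m n ->
  red_pt (e kk.1 m) (e kk.2 n) != red_pt (e kk.1 m) (e kk.2 n)^-1.
Proof.
move=> /Kset_bounds[km kn _]; apply/eqP => /rowP/(_ i2); rewrite !mxE /= => h.
have := mulf_neq0 (expipi_sub_inv R km) (expipi_sub_inv R kn).
move/eqP: h; rewrite -subr_eq0 !invfM invrK => /eqP h; rewrite -h => /eqP[].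
by ring.
Qed.

Lemma Cirr_disjoint kk ll p : kk \in Kset m n -> ll \in Kset m n ->
  Cirr R m n kk.1 kk.2 p -> Cirr R m n ll.1 ll.2 p -> kk = ll.
Proof.
move=> /Kset_bounds[km kn _] /Kset_bounds[lm ln _].
move=> /(CirrP _ km kn)[e1 e2] /(CirrP _ lm ln)[]; rewrite {}e1 {}e2.
move: kk ll km kn lm ln => [k k'] [l l'] /= km kn lm ln e1 e2.
by congr pair; apply: val_inj;
  [exact: expipi_add_inv_inj e1|exact: expipi_add_inv_inj e2].
Qed.

(* The equation tr(A^(m+1)) = tr(B^n A); at a node, where A^m = B^n = +-1, its
   x-derivative is (m+1) A^m - B^n = +-m. *)
Definition node_eq : {mpoly C[3]} :=
  lucas 'X_i0 2%:R 'X_i0 m.+1 - lucas 'X_i1 'X_i0 'X_i2 n.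

Lemma evp_lucas (c f g : {mpoly C[3]}) k p :
  evp (lucas c f g k) p = lucas (evp c p) (evp f p) (evp g p) k.
Proof. exact: rmorph_lucas. Qed.

Lemma node_eq_vanish p : Ccurve R m n p -> evp node_eq p = 0.
Proof.
move=> [chi [[A [B [[dA [dB AB]] ->]]] ->]].
rewrite Psi_character evpB !evp_lucas !evpX !trace_ptE {1}/evp rmorph_nat.
rewrite -mxtrace_expmx // [\tr (A *m B)]mxtrace_mulC -mxtrace_expmx_mul //.
by rewrite exprSr AB subrr.
Qed.

Lemma node_eq_deriv kk p : kk \in Kset m n -> Cirr R m n kk.1 kk.2 p ->
  evp (node_eq^`M(i0)) p != 0.
Proof.
move=> /Kset_bounds[km kn o] /(CirrP _ km kn)[p0 p1].
set a := e kk.1 m; set b := e kk.2 n.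
have aV : a * a^-1 = 1 by rewrite divff ?expipi_neq0.
have bV : b * b^-1 = 1 by rewrite divff ?expipi_neq0.
have am : a ^+ m = (-1) ^+ odd kk.1 by rewrite expipi_exp_m.
have bn : b ^+ n = (-1) ^+ odd kk.1 by rewrite expipi_exp_m // o.
have aVm : a^-1 ^+ m = (-1) ^+ odd kk.1 by rewrite exprVn am -exprVn invrN1.
have bVn : b^-1 ^+ n = (-1) ^+ odd kk.1 by rewrite exprVn bn -exprVn invrN1.
rewrite mderivB evpB.
(* Here [a^m] equals its inverse, so the factor [a - 1/a] cancels from the Dickson derivative
   formula. *)
have -> : evp ((lucas 'X_i0 2%:R 'X_i0 m.+1)^`M(i0)) p = m.+1%:R * (-1) ^+ odd kk.1.
  apply: (mulfI (expipi_sub_inv R km)).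
  rewrite (@lucas_D_deriv _ a a^-1
    (fun k => evp ((lucas 'X_i0 2%:R 'X_i0 k)^`M(i0)) p)) //.
  - by rewrite !exprS am aVm -/a; ring.
  - by rewrite /= -mpolyC_nat mderivC /evp meval0.
  - by rewrite /= mderivXU eqxx /evp meval1.
  move=> k; rewrite lucasSS mderivB mderivM mderivXU eqxx mul1r evpB evpD evpM.
  by rewrite !evp_lucas evpX p0 /evp rmorph_nat.
(* This recurrence has coefficient [y] and depends on [x] only through its initial value, so the
   derivative is the sequence starting with [1, 0], given by [lucas_V]. *)
have -> : evp ((lucas 'X_i1 'X_i0 'X_i2 n)^`M(i0)) p = (-1) ^+ odd kk.1.
  apply: (mulfI (expipi_sub_inv R kn)).
  rewrite (@lucas_unique _ (b + b^-1) (fun k => evp ((lucas 'X_i1 'X_i0 'X_i2 k)^`M(i0)) p)).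
    rewrite /= !mderivXU /= /evp meval1 meval0 lucas_V // bn bVn -/b.
    by ring.
  move=> k; rewrite lucasSS mderivB mderivM mderivXU /= mul0r add0r evpB evpM.
  by rewrite evpX p1.
have -> : m.+1%:R * (-1) ^+ odd kk.1 - (-1) ^+ odd kk.1 = m%:R * (-1) ^+ odd kk.1 :> C.
  by rewrite -addn1 natrD; ring.
by rewrite mulf_neq0 ?signr_eq0 // pnatr_eq0 -lt0n.
Qed.

(** At an intersection [t^n] and [t^m] differ from their inverses, so the right side of
    [deriv_dickson] is nonzero for both exponents. *)
Lemma red_velocity_neq0 kk t : t != 0 -> kk \in Kset m n ->
  Cirr R m n kk.1 kk.2 (polymap red_param (t + t^-1)) ->
  velocity red_param (t + t^-1) ord0 i0 != 0 /\
  velocity red_param (t + t^-1) ord0 i1 != 0.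
Proof.
move=> t0 /Kset_bounds[km kn _]; rewrite red_paramE // => irr.
have tn0 k : t ^+ k != 0 by rewrite expf_neq0.
have [ta tb] := red_pt_roots (tn0 n) (tn0 m) irr km kn.
have sub0 a l j : (0 < l < j)%N -> a = e l j \/ a = (e l j)^-1 -> a - a^-1 != 0.
  move=> lj [] ->; first exact: expipi_sub_inv.
  by rewrite invrK -opprB oppr_eq0 expipi_sub_inv.
have dk k : (0 < k)%N -> t ^+ k - (t ^+ k)^-1 != 0 ->
    (dickson k)^`().[t + t^-1] != 0.
  move=> k0 tk; have := deriv_dickson k t0; rewrite exprVn => dE.
  apply: contraNneq tk => d0; move/esym/eqP: dE; rewrite d0 mulr0.
  by rewrite mulf_eq0 pnatr_eq0 eqn0Ngt k0.
rewrite !mxE /red_param /=.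
by split; apply: dk => //; [exact: sub0 ta|exact: sub0 tb].
Qed.

Lemma branch_line o : o \in branches -> exists phi psi,
  [/\ forall t, branch o (polymap phi t), forall t, evp psi (polymap phi t) = t &
      forall p, branch o p -> polymap phi (evp psi p) = p].
Proof.
case: o => [kk|_] /=.
  rewrite Some_branches => /Kset_bounds[km kn _].
  exists (irr_param (cos2 kk.1 m) (cos2 kk.2 n)), 'X_i2.
  split; [move=> t; exact: irr_param_Cirr|exact: irr_paramK|].
  by move=> p; exact: Cirr_irr_param.
have [psi psiK] := red_param_inverse; exists red_param, psi.
split=> //; first exact: red_param_Cred.
by move=> p /Cred_red_param[t _ ->]; rewrite psiK.
Qed.

Lemma branch_closed o : o \in branches -> zclosed (branch o).
Proof. by move=> /branch_line[phi [psi [h1 h2 h3]]]; exact: line_zclosed h1 h3. Qed.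

Lemma branch_irreducible o : o \in branches -> irreducible_set (branch o).
Proof. by move=> /branch_line[phi [psi [h1 h2 h3]]]; exact: line_irreducible h1 h3. Qed.

Lemma branch_smooth o p : o \in branches -> branch o p -> smooth_point (branch o) p.
Proof. by move=> /branch_line[phi [psi [h1 h2 h3]]]; exact: line_smooth h1 h2 h3 _. Qed.

Lemma node_at kk p : kk \in Kset m n -> Cred R m n p -> Cirr R m n kk.1 kk.2 p ->
  node_of (Ccurve R m n) (Cred R m n) (Cirr R m n kk.1 kk.2) p.
Proof.
move=> kkK red irr; have [km kn _] := Kset_bounds kkK.
have [psi psiK] := red_param_inverse.
have redK q : Cred R m n q -> polymap red_param (evp psi q) = q.
  by move=> /Cred_red_param[t _ ->]; rewrite psiK.
have irrK := Cirr_irr_param km kn.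
have tanr := line_tangent red_param_Cred psiK redK.
have tani := line_tangent (fun t => irr_param_Cirr t km kn) (irr_paramK _ _) irrK.
have smr : smooth_point (Cred R m n) p by exact: (@branch_smooth None).
have smi : smooth_point (Cirr R m n kk.1 kk.2) p.
  by apply: (@branch_smooth (Some kk)); rewrite ?Some_branches.
have [t t0 pE] := Cred_red_param red.
have [v0 v1] : velocity red_param (t + t^-1) ord0 i0 != 0 /\
    velocity red_param (t + t^-1) ord0 i1 != 0.
  by apply: (@red_velocity_neq0 kk) => //; rewrite -pE.
have {}tanr w := tanr (t + t^-1) w; rewrite -pE in tanr.
have {}tani w := tani (evp 'X_i2 p) w; rewrite irrK // irr_velocity in tani.
move: (velocity red_param _) v0 v1 tanr => v v0 v1 tanr; set e2 := (\row_(i < 3) _) in tani.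
have subr : subset_pt (Cred R m n) (Ccurve R m n).
  by move=> q rq; apply/Ccurve_branches; exists None.
have subi : subset_pt (Cirr R m n kk.1 kk.2) (Ccurve R m n).
  by move=> q iq; apply/Ccurve_branches; exists (Some kk); rewrite ?Some_branches.
split=> // [w|w].
  (* The vertical direction [e2] has first coordinate zero, while that of [v] is nonzero. *)
  move=> /tanr[c ->] /tani[d /rowP/(_ i0)/eqP].
  by rewrite !mxE /= mulr0 mulf_eq0 (negPf v0) orbF => /eqP ->; rewrite scale0r.
split=> [wC|[u1 [u2 [u1T u2T ->]]]]; last first.
  by apply: tangent_spaceD; [exact: tangent_space_sub u1T|exact: tangent_space_sub u2T].
have vC : tangent_space (Ccurve R m n) p v.
  by apply: (tangent_space_sub subr); apply/tanr; exists 1; rewrite scale1r.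
have eC : tangent_space (Ccurve R m n) p e2.
  by apply: (tangent_space_sub subi); apply/tani; exists 1; rewrite scale1r.
(* Tangency of [e2] kills the [z]-derivative. Both [v] and [w] then satisfy one nontrivial relation
   on their first two coordinates, which are thus proportional. *)
have f0 := node_eq_deriv kkK irr.
have := eC _ node_eq_vanish; rewrite sum3E !mxE /= !mulr0 !add0r mulr1 => f2.
have := vC _ node_eq_vanish; rewrite sum3E f2 mul0r addr0 => fv.
have := wC _ node_eq_vanish; rewrite sum3E f2 mul0r addr0 => fw.
set c := w ord0 i1 / v ord0 i1.
exists (c *: v), ((w ord0 i2 - c * v ord0 i2) *: e2); split.
- by apply/tanr; exists c.
- by apply/tani; exists (w ord0 i2 - c * v ord0 i2).
have c1 : c * v ord0 i1 = w ord0 i1 by rewrite divfK.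
apply/rowP; apply: ord3P; rewrite !mxE /=.
- rewrite mulr0 addr0; apply: (mulfI f0); apply/eqP; rewrite -subr_eq0.
  set f1 := evp (node_eq^`M(i1)) p in fv fw.
  have -> : forall f w0 v0, f * w0 - f * (c * v0) =
      (f * w0 + f1 * w ord0 i1) - c * (f * v0 + f1 * v ord0 i1).
    by move=> f w0' v0'; rewrite -c1; ring.
  by rewrite fw fv mulr0 subrr.
- by rewrite mulr0 addr0 c1.
by rewrite mulr1 addrC subrK.
Qed.

(** Distinct vertical lines are disjoint; a vertical line inside the reducible curve would
    contradict transversality at a node; and the point of the trivial representation lies on the
    reducible curve but on no vertical line. *)
Lemma branch_antichain o o' : o \in branches -> o' \in branches ->
  subset_pt (branch o) (branch o') -> o = o'.
Proof.
case: o => [kk|]; case: o' => [ll|] //; rewrite ?Some_branches.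
- move=> kkK llK sub; have [km kn _] := Kset_bounds kkK.
  have irr := irr_param_Cirr 0 km kn.
  by rewrite (Cirr_disjoint kkK llK irr (sub _ irr)).
- move=> kkK _ sub; exfalso.
  have [red irr] := iffRL (Cred_Cirr _ kkK) (or_introl erefl).
  have [_ [v [v0 l]] disj _] := node_at kkK red irr.
  have vi : tangent_space (Cirr R m n kk.1 kk.2) (red_pt (e kk.1 m) (e kk.2 n)) v.
    by apply/l; exists 1; rewrite scale1r.
  by move/eqP: v0; apply; apply: disj => //; exact: tangent_space_sub vi.
move=> _ llK sub; have [lm ln _] := Kset_bounds llK.
have : Cred R m n (red_pt 1 1).
  by apply/CredP; exists 1, 1; rewrite oner_eq0 !expr1n.
have o0 := oner_neq0 C.
move=> /sub irr; have [[l1|l1] _] := red_pt_roots o0 o0 irr lm ln.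
  by have := expipi_neq1 R lm; rewrite -l1 eqxx.
by have := expipi_neq1 R lm; rewrite -[e _ _]invrK -l1 invr1 eqxx.
Qed.

Lemma Ccurve_closed : zclosed (Ccurve R m n).
Proof.
apply: zclosed_ext (zclosed_bigU branch_closed) => p.
by apply: iff_sym; exact: Ccurve_branches.
Qed.

(** Away from the intersections only one branch passes through [p], and [smooth_point_bigU] applies;
    which branches contain [p] is settled by [zclosed_dec]. *)
Lemma singular_points p : Ccurve R m n p ->
  ~ smooth_point (Ccurve R m n) p <->
  exists2 kk, kk \in Kset m n & Cred R m n p /\ Cirr R m n kk.1 kk.2 p.
Proof.
move=> pC; split=> [nsm|[kk kkK [red irr]]]; last first.
  exact: node_not_smooth (node_at kkK red irr).
have smooth o : o \in branches -> branch o p ->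
    (forall o', o' \in branches -> branch o' p -> o' = o) -> False.
  move=> oB op only; apply: nsm.
  by apply: (smooth_point_bigU branch_closed Ccurve_branches oB op only);
    exact: branch_smooth.
have noneB : None \in branches by rewrite mem_head.
have [red|nred] := zclosed_dec p (branch_closed noneB); last first.
  have [[kk|] kB irr] := iffLR (Ccurve_branches p) pC; last by [].
  exfalso; apply: (smooth _ kB irr) => -[ll|] lB irr'; last by case: nred.
  by move: kB lB; rewrite !Some_branches => kB lB; rewrite (Cirr_disjoint kB lB irr irr').
have irrU := zclosed_bigU (r := enum (Kset m n)) (U := fun kk => branch (Some kk)).
have [|[kk kkK irr]|nirr] := zclosed_dec p (irrU _).
- by move=> kk; rewrite mem_enum -Some_branches; exact: branch_closed.
- by move: kkK; rewrite mem_enum => kkK; exists kk.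
exfalso; apply: (smooth _ noneB red) => -[kk|] //; rewrite Some_branches => kB irr.
by case: nirr; exists kk; rewrite ?mem_enum.
Qed.

End TorusKnot.

Theorem theorem3p1 (R : realType) (m n : nat) :
  (0 < m)%N -> (0 < n)%N -> coprime m n ->
  (* Psi : X(G_{m,n}) -> C is an isomorphism onto its image C *)
  (forall chi1 chi2, char_var R m n chi1 -> char_var R m n chi2 ->
     Psi chi1 = Psi chi2 -> chi1 = chi2) /\
  (forall w : seq letter, exists P : {mpoly (complex R)[3]},
     forall chi, char_var R m n chi -> chi w = evp P (Psi chi)) /\
  zclosed (Ccurve R m n) /\
  (* the irreducible components of C *)
  (forall T, irr_component (Ccurve R m n) T <->
     seteq_pt T (Cred R m n) \/
     exists2 kk, kk \in Kset m n & seteq_pt T (Cirr R m n kk.1 kk.2)) /\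
  (* there are exactly (m-1)(n-1)/2 + 1 of them *)
  #|Kset m n| = ((m.-1 * n.-1) %/ 2)%N /\
  (forall kk, kk \in Kset m n -> ~ seteq_pt (Cirr R m n kk.1 kk.2) (Cred R m n)) /\
  (forall kk ll, kk \in Kset m n -> ll \in Kset m n ->
     seteq_pt (Cirr R m n kk.1 kk.2) (Cirr R m n ll.1 ll.2) -> kk = ll) /\
  (* each component is isomorphic to C and smooth *)
  (iso_to_line (Cred R m n) /\ forall p, Cred R m n p -> smooth_point (Cred R m n) p) /\
  (forall kk, kk \in Kset m n ->
     iso_to_line (Cirr R m n kk.1 kk.2) /\
     forall p, Cirr R m n kk.1 kk.2 p -> smooth_point (Cirr R m n kk.1 kk.2) p) /\
  (* the irreducible-character components are pairwise disjoint *)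
  (forall kk ll p, kk \in Kset m n -> ll \in Kset m n -> kk != ll ->
     ~ (Cirr R m n kk.1 kk.2 p /\ Cirr R m n ll.1 ll.2 p)) /\
  (* each meets the reducible component in exactly two points *)
  (forall kk, kk \in Kset m n -> exists p1 p2 : pt R, p1 != p2 /\
     forall p, (Cred R m n p /\ Cirr R m n kk.1 kk.2 p) <-> (p = p1 \/ p = p2)) /\
  (* transversal intersections forming nodes of C *)
  (forall kk p, kk \in Kset m n -> Cred R m n p -> Cirr R m n kk.1 kk.2 p ->
     node_of (Ccurve R m n) (Cred R m n) (Cirr R m n kk.1 kk.2) p) /\
  (* C has no other singularities *)
  (forall p, Ccurve R m n p ->
     (~ smooth_point (Ccurve R m n) p <->
      exists2 kk, kk \in Kset m n & Cred R m n p /\ Cirr R m n kk.1 kk.2 p)).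
Proof.
move=> m0 n0 mn.
have cover := @Ccurve_branches R m n m0 n0.
split.
  move=> chi1 chi2 [A [B [[dA [dB _]] ->]]] [A' [B' [[dA' [dB' _]] ->]]].
  (* Characters are functions on words, so their equality is checked word by word, each value being
     a polynomial in the trace coordinates. *)
  rewrite !Psi_character => e; apply: functional_extensionality => w.
  by have [f fE] := fricke_polynomial R w; rewrite !fE // e.
split.
  move=> w; have [f fE] := fricke_polynomial R w; exists f.
  by move=> chi [A [B [[dA [dB _]] ->]]]; rewrite Psi_character fE.
split; first exact: Ccurve_closed.
split.
  move=> T; have := irr_component_bigU T (@branch_irreducible R m n m0 mn)
    (@branch_antichain R m n m0 n0 mn) cover => h.
  apply: iff_trans h _.
  split=> [[[kk|] kkB TU]|[TU|[kk kkK TU]]].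
  - by right; exists kk; rewrite -?Some_branches.
  - by left.
  - by exists None.
  - by exists (Some kk); rewrite ?Some_branches.
split; first exact: card_Kset.
split.
  move=> kk kkK e; have := @branch_antichain R m n m0 n0 mn (Some kk) None.
  by rewrite Some_branches => /(_ kkK (mem_head _ _)) h; have := h (fun p => iffLR (e p)).
split.
  move=> kk ll kkK llK e; have := @branch_antichain R m n m0 n0 mn (Some kk) (Some ll).
  by rewrite !Some_branches => /(_ kkK llK (fun p => iffLR (e p))) [].
split.
  split; last by move=> p; exact: (@branch_smooth R m n m0 mn None).
  by have [phi [psi h]] := @branch_line R m n m0 mn None (mem_head _ _); exists phi, psi.
split.
  move=> kk; rewrite -Some_branches => kkK; split.
    by have [phi [psi h]] := branch_line R m0 mn kkK; exists phi, psi.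
  by move=> p; exact: (branch_smooth m0 mn kkK).
split.
  move=> kk ll p kkK llK /eqP ne [h1 h2]; apply: ne.
  exact: Cirr_disjoint h1 h2.
split.
  (* Together with the disjointness just shown, this makes all intersection points distinct. *)
  move=> kk kkK; do 2 eexists; split; first exact: nodes_distinct kkK.
  by move=> p; exact: Cred_Cirr.
split; first by move=> kk p; exact: node_at.
by move=> p; exact: singular_points.
Qed.
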